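(* The decision problem $\textsc{MVDSP}$ on directed graphs with non-negative rational edge weights can be solved in $2^{O(\ell)}\cdot\mathrm{poly}(n)$ time.
   Context: $\textsc{MVDSP}$ (decision version) is defined as follows. The input is a (directed or undirected) graph $G=(V,E)$ with $n$ vertices, an edge-length function $w\colon E\to\mathbb{Q}_{\ge 0}$, terminal pairs $(s_1,t_1),\dots,(s_k,t_k)$ with $s_i\neq t_i$ for every $i$, and an integer $p$. The question is whether there is a set $S\subseteq[k]$ with $|S|\ge p$ and a collection $\{P_i\}_{i\in S}$ of pairwise vertex-disjoint paths (disjoint including end vertices) such that each $P_i$ is a shortest $s_i$-$t_i$-path in $G$ with respect to $w$. The parameter $\ell$ is the minimum total number of edges in the paths of such a solution if the instance is a yes-instance, and $\ell=n$ otherwise.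
   Formalization: The time bound carries an extra term O(k) for reading the k terminal pairs, which may repeat (for distinct pairs k ≤ n² and it is absorbed in poly(n)); time is counted on a unit-cost RAM that adds and compares rational weights. *)

(* Defs.v *)
From HB Require Import structures.
From mathcomp Require Import all_boot all_order all_algebra.
From mathcomp Require Import boolp.

Set Implicit Arguments.
Unset Strict Implicit.
Unset Printing Implicit Defensive.

Import Order.TTheory GRing.Theory Num.Theory.

Local Open Scope ring_scope.

(** * The problem MVDSP on directed graphs *)

(* [wt] is only meaningful on the edges; its other values are irrelevant (and
   are hidden from the algorithm by [encode] below). *)
Record instance := Instance {
  nv : nat;
  edge : rel 'I_nv;
  wt : 'I_nv -> 'I_nv -> rat;
  wt_ge0 : forall u v, edge u v -> 0 <= wt u v;
  npairs : nat;
  src : 'I_npairs -> 'I_nv;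
  snk : 'I_npairs -> 'I_nv;
  src_neq_snk : forall i, src i != snk i;
  thr : int
}.

Section Problem.
Variable I : instance.
Implicit Types (s t u v : 'I_(nv I)) (p q : seq 'I_(nv I)).

(* As in [path], a path is given by its first vertex [s] and the sequence [p] of
   the vertices that follow; so [size p] is its number of edges. *)
Definition is_path s t p : Prop :=
  [/\ path (@edge I) s p, uniq (s :: p) & last s p = t].

Fixpoint path_length s p : rat :=
  if p is v :: q then wt s v + path_length v q else 0.

Definition is_shortest_path s t p : Prop :=
  is_path s t p /\ forall q, is_path s t q -> path_length s p <= path_length s q.

(* Only the values of [P] on [S] matter. *)
Definition solution (S : {set 'I_(npairs I)})
    (P : 'I_(npairs I) -> seq 'I_(nv I)) : Prop :=
  [/\ thr I <= #|S|%:Z,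
      forall i, i \in S -> is_shortest_path (src i) (snk i) (P i)
    & forall i j, i \in S -> j \in S -> i != j ->
        [disjoint src i :: P i & src j :: P j]].

Definition yes_instance : Prop := exists S P, solution S P.

Definition has_solution_with_edges (l : nat) : Prop :=
  exists S P, solution S P /\ (\sum_(i in S) size (P i))%N = l.

Definition ell : nat :=
  match pselect (exists l, `[< has_solution_with_edges l >]) with
  | left ex_l => ex_minn ex_l
  | right _ => nv I
  end.

End Problem.

(** * The model of computation *)

(* A random access machine for the comparison-addition model: a structured
   program works on finitely many arrays of natural numbers and finitely many
   arrays of rational weights (the arrays it names), with indirect addressing.
   Natural numbers can be added, subtracted (truncated at 0) and compared;
   weights can only be added and compared.  Every assignment and every test
   costs one unit.  There is no multiplication, so that the bit size of every
   cell content stays polynomial in the running time and the bit size of the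
   input: unit cost is then polynomially related to Turing machine time. *)

Inductive nexp :=
| NConst of nat
| NGet of nat & nexp            (* array name, index *)
| NAdd of nexp & nexp
| NSub of nexp & nexp.

Inductive wexp :=
| WGet of nat & nexp            (* array name, index *)
| WAdd of wexp & wexp.

Inductive test :=
| NLe of nexp & nexp
| WLe of wexp & wexp
| TNot of test
| TAnd of test & test.

Inductive cmd :=
| Skip
| NSet of nat & nexp & nexp     (* array name, index, value *)
| WSet of nat & nexp & wexp     (* array name, index, value *)
| Seq of cmd & cmd
| If of test & cmd & cmd
| While of test & cmd.

Record memory := Memory {
  nmem : nat -> nat -> nat;
  wmem : nat -> nat -> rat
}.

Definition upd (T : Type) (m : nat -> nat -> T) (a i : nat) (x : T) :=
  fun b j => if (b == a) && (j == i) then x else m b j.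

Fixpoint neval (m : memory) (e : nexp) : nat :=
  match e with
  | NConst c => c
  | NGet a e1 => nmem m a (neval m e1)
  | NAdd e1 e2 => (neval m e1 + neval m e2)%N
  | NSub e1 e2 => (neval m e1 - neval m e2)%N
  end.

Fixpoint weval (m : memory) (e : wexp) : rat :=
  match e with
  | WGet a e1 => wmem m a (neval m e1)
  | WAdd e1 e2 => weval m e1 + weval m e2
  end.

Fixpoint teval (m : memory) (b : test) : bool :=
  match b with
  | NLe e1 e2 => (neval m e1 <= neval m e2)%N
  | WLe e1 e2 => weval m e1 <= weval m e2
  | TNot b1 => ~~ teval m b1
  | TAnd b1 b2 => teval m b1 && teval m b2
  end.

(* [exec c m t m']: started in memory [m], the program [c] halts after [t] units
   of time in memory [m'].  An expression has constant size for a fixed program,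
   hence its evaluation is included in the unit charged to its command. *)
Inductive exec : cmd -> memory -> nat -> memory -> Prop :=
| ExecSkip m : exec Skip m 1 m
| ExecNSet a i e m :
    exec (NSet a i e) m 1
      (Memory (upd (nmem m) a (neval m i) (neval m e)) (wmem m))
| ExecWSet a i e m :
    exec (WSet a i e) m 1
      (Memory (nmem m) (upd (wmem m) a (neval m i) (weval m e)))
| ExecSeq c1 c2 m m1 m2 t1 t2 :
    exec c1 m t1 m1 -> exec c2 m1 t2 m2 -> exec (Seq c1 c2) m (t1 + t2)%N m2
| ExecIf b c1 c2 m t m' :
    exec (if teval m b then c1 else c2) m t m' -> exec (If b c1 c2) m t.+1 m'
| ExecWhileDone b c m : ~~ teval m b -> exec (While b c) m 1 m
| ExecWhileStep b c m m1 m2 t1 t2 :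
    teval m b -> exec c m t1 m1 -> exec (While b c) m1 t2 m2 ->
    exec (While b c) m (t1 + t2).+1%N m2.

(** * Deciding MVDSP *)

(* Entry at position [i] of the row-major layout of an [n * n] matrix: the
   coefficient [(u, v)] sits at position [u * n + v]. *)
Definition row_major (T : Type) (x0 : T) (n : nat) (f : 'I_n -> 'I_n -> T)
    (i : nat) : T :=
  match insub (i %/ n)%N, insub (i %% n)%N with
  | Some u, Some v => f u v
  | _, _ => x0
  end.

Definition ord_array (k n : nat) (f : 'I_k -> 'I_n) (i : nat) : nat :=
  if insub i is Some j then f j else 0%N.

(* Initial memory.  Arrays of naturals:
     0: n, k, the sign of p (1 if p < 0), |p|
     1: the sources        2: the sinks        3: the adjacency matrix
   Array 0 of weights: the weights of the edges.  All other cells hold 0. *)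
Definition encode (I : instance) : memory :=
  Memory
    (fun a i =>
       match a with
       | 0 => nth 0%N [:: nv I; npairs I; nat_of_bool (thr I < 0); `|thr I|%N] i
       | 1 => ord_array (@src I) i
       | 2 => ord_array (@snk I) i
       | 3 => row_major 0%N (fun u v => nat_of_bool (@edge I u v)) i
       | _ => 0%N
       end)
    (fun a i =>
       if a is 0 then
         row_major 0 (fun u v => if @edge I u v then wt u v else 0) i
       else 0).

(* The answer is read in cell 0 of array 0; nonzero means "yes". *)
Definition decides_MVDSP_in_time (c : cmd) (T : instance -> nat) : Prop :=
  forall I : instance, exists t m,
    [/\ exec c (encode I) t m, (t <= T I)%N
      & nmem m 0 0 <> 0%N <-> yes_instance I].

(* Main.v *)
Require Import Defs.
From mathcomp Require Import all_boot all_order all_algebra.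
From mathcomp Require Import fieldext finfield falgebra boolp zify.

(* Let d be the distance function of a source s.  A simple path from s is a
   shortest path if and only if each of its edges uv is tight, that is
   d(v) = d(u) + w(uv).  Hence a solution is a sequence of distinct vertices that
   is parsed, one vertex at a time, into tight paths joining terminal pairs; the
   state of this parser consists of the current source and end vertex, the number
   of paths already closed and the number of vertices read.  As no path is empty,
   a solution with l edges has at most 2 l vertices, so it suffices to look, for
   K = 0, 1, 2, ..., for a sequence of at most K vertices.

   This is done with representative families in the style of Monien.  Let U be a
   family of vertex sets that shatters every set of at most K vertices.  A partial
   solution with state q and vertex set A is kept only if some member of U
   contains A and contains no vertex set kept before with the same state.  When a
   solution has read its prefix A and still has to read the set B, some member of
   U contains A and avoids B; so a kept set with the same state avoids B as well,
   and can replace A.  Each kept set owns a pair of a state and a member of U, so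
   that there are at most (n + 1)^4 |U| of them.

   U consists of all binary linear recurring sequences of order m = K + log n, of
   which there are 4^m.  It shatters every set T of at most K positions: there
   are fewer than 2^K nonzero polynomials over F_2 with support in T, so they do
   not vanish at some x in GF(2^m), whose powers x^i, i in T, are then linearly
   independent over F_2; every 0-1 pattern on T is hence of the form phi(x^i) for
   an F_2-linear form phi, and phi(x^i) satisfies the linear recurrence given by
   the minimal polynomial of x. *)

Set Implicit Arguments.
Unset Strict Implicit.
Unset Printing Implicit Defensive.

Import Order.TTheory GRing.Theory Num.Theory.

(** * Powers of an element of GF(2^m) *)

Section FieldOfOrderPowerOfTwo.

Local Open Scope ring_scope.

Lemma F2_neq0D (a b : 'F_2) : (a + b != 0) = (a != 0) (+) (b != 0).
Proof. by case: a b => [[|[|?]] ?] [[|[|?]] ?]. Qed.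

Lemma F2_neq0M (a b : 'F_2) : (a * b != 0) = (a != 0) && (b != 0).
Proof. by rewrite mulf_eq0 negb_or. Qed.

Lemma F2_eq_nat (a : 'F_2) : a = (a != 0)%:R.
Proof. by case: a => [[|[|?]] ?] //; apply: val_inj. Qed.

Lemma F2_sum_neq0 (I : Type) (s : seq I) (P : pred I) (f : I -> 'F_2) :
  (\sum_(i <- s | P i) f i != 0) = \big[addb/false]_(i <- s | P i) (f i != 0).
Proof.
by apply: (big_morph (fun a : 'F_2 => a != 0)) => [a b|]; rewrite ?F2_neq0D ?eqxx.
Qed.

Lemma ex_common_nonroot (F : finFieldType) (I : finType) (P : pred I)
    (p : I -> {poly F}) (d : nat) :
  (forall i, P i -> p i != 0 /\ (size (p i) <= d.+1)%N) ->
  (#|P| * d < #|F|)%N -> exists x, forall i, P i -> ~~ root (p i) x.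
Proof.
move=> pP ltF; pose q := \prod_(i | P i) p i.
have q_neq0 : q != 0 by apply/prodf_neq0 => i /pP[].
have size_q : (size q <= (#|P| * d).+1)%N.
  rewrite /q size_prod; last by move=> i /pP[].
  rewrite leq_subLR addnS ltnS -sum_nat_const -sum1_card -big_split /=.
  by apply: leq_sum => i /pP[_]; rewrite add1n.
have: ~~ all (root q) (enum F).
  apply/negP => /max_poly_roots/(_ (enum_uniq _)) => /(_ q_neq0).
  by rewrite -cardE => /leq_trans/(_ size_q); rewrite ltnS leqNgt ltF.
case/allPn => x _; rewrite /root horner_prod => /prodf_neq0 xP.
by exists x => i /xP.
Qed.

(* The [F_2]-relations among the powers [x ^+ (m + v)], [v \in T], are the roots
   [x] of polynomials that are sums of monomials. *)
Lemma ex_subset_sums_neq0 (F : finFieldType) (m n k : nat) (T : {set 'I_n}) :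
  (n * 2 ^ k <= #|F|)%N -> (#|T| <= k)%N ->
  exists x : F, forall C : {set 'I_n}, C \subset T -> C != set0 ->
    \sum_(v in C) x ^+ (m + v) != 0.
Proof.
case: n T => [|n] T leF leTk.
  by exists 0 => C _ /set0Pn[[]].
pose p (C : {set 'I_n.+1}) : {poly F} := \sum_(v in C) 'X^v.
have p_coef (C : {set 'I_n.+1}) (v : 'I_n.+1) : (p C)`_v = (v \in C)%:R.
  rewrite /p coef_sum; under eq_bigr do rewrite coefXn.
  case: (boolP (v \in C)) => [Cv|C'v].
    rewrite (bigD1 v) //= eqxx big1 ?addr0 // => w /andP[_].
    by rewrite -val_eqE eq_sym => /negPf->.
  rewrite big1 // => w Cw; case: eqP => // /val_inj eqw.
  by rewrite eqw Cw in C'v.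
have p_neq0 C : C != set0 -> p C != 0.
  case/set0Pn => v Cv; apply/eqP => pC0.
  by have := p_coef C v; rewrite pC0 coef0 Cv => /eqP; rewrite eq_sym oner_eq0.
have p_size C : (size (p C) <= n.+1)%N.
  apply: leq_trans (size_sum _ _ _) _; apply/bigmax_leqP => v _.
  by rewrite size_polyXn.
pose P := [pred C : {set 'I_n.+1} | (C \subset T) && (C != set0)].
have [||x xP] := @ex_common_nonroot F _ P (fun C => 'X * p C) n.+1.
- move=> C /andP[_ /p_neq0 pC0]; split; first by rewrite mulf_neq0 ?polyX_eq0.
  by rewrite mulrC size_mulX ?ltnS.
- apply: leq_trans leF; rewrite mulnC ltn_pmul2l //.
  have -> : #|P| = #|powerset T :\ set0|.
    by apply: eq_card => C; rewrite !inE andbC.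
  have := cardsD1 set0 (powerset T); rewrite inE sub0set card_powerset add1n.
  by move=> eqT; apply: leq_trans (_ : 2 ^ #|T| <= _)%N; rewrite ?leq_exp2l // eqT.
exists x => C sCT C0; have := xP C; rewrite /P /= sCT C0 => /(_ isT).
rewrite /root hornerM hornerX mulf_eq0 negb_or => /andP[x0].
rewrite /p horner_sum => sum0.
under eq_bigr do rewrite exprD.
rewrite -mulr_sumr mulf_neq0 ?expf_neq0 //.
by under eq_bigr do rewrite -hornerXn.
Qed.

Lemma lin_rec_universal (m n k : nat) (T : {set 'I_n}) (g : 'I_n -> bool) :
  (0 < m)%N -> (n * 2 ^ k <= 2 ^ m)%N -> (#|T| <= k)%N ->
  exists a r : nat -> bool,
    (forall i, r (m + i)%N = \big[addb/false]_(j < m) (a j && r (i + j)%N)) /\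
    (forall v, v \in T -> r (m + v)%N = g v).
Proof.
move=> m_gt0 le2m leTk.
have [F0 pcharF cardF] := pPrimePowerField (isT : prime 2) m_gt0.
pose L := pPrimeCharType pcharF.
have [x xP] := @ex_subset_sums_neq0 F0 m n k T ltac:(by rewrite cardF) leTk.
pose y : L := x.
pose X := [tuple of [seq y ^+ (m + v) | v : 'I_n <- enum T]].
have freeX : free X.
  apply/freeP => c sum0 i; apply/eqP/negPn/negP => ci0.
  pose C := [set enum_val j | j : 'I_#|T| & c j != 0].
  have sCT : C \subset T.
    by apply/subsetP => _ /imsetP[j _ ->]; apply: enum_valP.
  have C0 : C != set0.
    by apply/set0Pn; exists (enum_val i); rewrite imset_f // inE.
  have /negP[] := xP C sCT C0; rewrite -[X in _ == X]sum0.
  rewrite big_imset /=; last by move=> ? ? _ _; apply: enum_val_inj.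
  rewrite [X in _ == X](bigID (fun j => c j != 0)) /= [X in _ + X]big1 ?addr0.
    apply/eqP; apply: eq_big => [j|j]; rewrite inE // => cj0.
    rewrite [c j]F2_eq_nat cj0 scale1r (nth_map (enum_val j)) -?cardE //.
    by rewrite -enum_val_nth.
  by move=> j /negPn/eqP->; rewrite scale0r.
pose phi (z : L) : 'F_2 := \sum_i (g (enum_val i))%:R * coord X i z.
have phi_sum (I : finType) (b : I -> 'F_2) (z : I -> L) :
    phi (\sum_j b j *: z j) = \sum_j b j * phi (z j).
  rewrite /phi; under eq_bigr do rewrite linear_sum mulr_sumr.
  rewrite exchange_big; apply: eq_bigr => j _; rewrite mulr_sumr.
  by apply: eq_bigr => i _; rewrite linearZ /= mulrCA.
have [a aP] : exists a : nat -> 'F_2, y ^+ m = \sum_(j < m) a j *: y ^+ j.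
  pose K := 1%AS : {subfield L}.
  have le_dm : (adjoin_degree K y <= m)%N.
    rewrite adjoin_degreeE /dim_sup_field dimv1 divn1.
    by rewrite (leq_trans (dimvS (subvf _))) // pprimeChar_dimf cardF pfactorK.
  pose q := minPoly K y * 'X^(m - adjoin_degree K y).
  have q_monic : q \is monic by rewrite monicMr ?monicXn // monic_minPoly.
  have q_size : size q = m.+1.
    by rewrite size_Mmonic ?monicXn ?monic_neq0 ?monic_minPoly //
      size_minPoly size_polyXn addSn addnS /= subnKC.
  have q_root : q.[y] = 0 by rewrite hornerM minPolyxx mul0r.
  have q_over : q \is a polyOver K by rewrite rpredM ?minPolyOver ?rpredX ?polyOverX.
  have coefK i : {c : 'F_2 | q`_i == c%:A}.
    by apply: sigW; have /vlineP[c ->] := polyOverP q_over i; exists c.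
  exists (fun i => - sval (coefK i)).
  move: q_root; rewrite horner_coef q_size big_ord_recr /=.
  move/monicP: (q_monic); rewrite lead_coefE q_size /= => ->; rewrite mul1r.
  move/eqP; rewrite addrC addr_eq0 => /eqP ->; rewrite -sumrN.
  apply: eq_bigr => j _; rewrite scaleNr; congr (- _).
  by case: (coefK j) => c /= /eqP->; rewrite -scalerAl mul1r.
exists (fun j => a j != 0), (fun i => phi (y ^+ i) != 0); split=> [i | v Tv].
  rewrite exprD aP mulr_suml.
  under eq_bigr do rewrite -scalerAl -exprD addnC.
  by rewrite phi_sum F2_sum_neq0; apply: eq_bigr => j _; rewrite F2_neq0M.
have -> : y ^+ (m + v) = X`_(enum_rank_in Tv v).
  rewrite (nth_map v) -?cardE //.
  by rewrite -enum_val_nth enum_rankK_in.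
rewrite /phi (bigD1 (enum_rank_in Tv v)) //= coord_free // eqxx mulr1.
rewrite enum_rankK_in // big1 ?addr0; first by case: (g v).
by move=> i /negPf ne_i; rewrite coord_free // eq_sym ne_i mulr0.
Qed.

End FieldOfOrderPowerOfTwo.

(** * Running time and frames of programs *)

Fixpoint nwrites (c : cmd) : seq nat :=
  match c with
  | NSet a _ _ => [:: a]
  | Defs.Seq c1 c2 | If _ c1 c2 => nwrites c1 ++ nwrites c2
  | While _ c1 => nwrites c1
  | _ => [::]
  end.

Fixpoint wwrites (c : cmd) : seq nat :=
  match c with
  | WSet a _ _ => [:: a]
  | Defs.Seq c1 c2 | If _ c1 c2 => wwrites c1 ++ wwrites c2
  | While _ c1 => wwrites c1
  | _ => [::]
  end.

Definition same (nw ww : seq nat) (m m' : memory) : Prop :=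
  (forall a, a \notin nw -> nmem m' a = nmem m a) /\
  (forall a, a \notin ww -> wmem m' a = wmem m a).

Definition frame (c : cmd) := same (nwrites c) (wwrites c).

Lemma same_refl nw ww m : same nw ww m m.
Proof. by []. Qed.

Lemma same_trans nw ww m1 m2 m3 :
  same nw ww m1 m2 -> same nw ww m2 m3 -> same nw ww m1 m3.
Proof.
move=> [n12 w12] [n23 w23].
by split=> a aP; [rewrite n23 ?n12 | rewrite w23 ?w12].
Qed.

Lemma same_sub nw ww nw' ww' m m' :
  {subset nw <= nw'} -> {subset ww <= ww'} ->
  same nw ww m m' -> same nw' ww' m m'.
Proof.
move=> sn sw [n12 w12].
split=> a aP; first by apply: n12; apply: contra aP; apply: sn.
by apply: w12; apply: contra aP; apply: sw.
Qed.

Arguments upd T m a i x b / j : assert.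

Lemma exec_frame c m t m' : exec c m t m' -> frame c m m'.
Proof.
elim=> {c m t m'} //=.
- move=> a i e m; split=> // b; rewrite inE => /negPf ba /=.
  by apply: funext => j; rewrite /upd ba.
- move=> a i e m; split=> // b; rewrite inE => /negPf ba /=.
  by apply: funext => j; rewrite /upd ba.
- move=> c1 c2 m m1 m2 t1 t2 _ H1 _ H2; apply: same_trans.
    by apply: same_sub H1 => a; rewrite mem_cat => ->.
  by apply: same_sub H2 => a; rewrite mem_cat orbC => ->.
- move=> b c1 c2 m t m' _; case: (teval m b) => H.
    by apply: same_sub H => a; rewrite /= mem_cat => ->.
  by apply: same_sub H => a; rewrite /= mem_cat orbC => ->.
- by move=> b c m m1 m2 t1 t2 _ _ H1 _ H2; apply: same_trans H1 H2.
Qed.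

(* Running time when every loop makes at most [N] iterations. *)
Fixpoint cost (N : nat) (c : cmd) : nat :=
  match c with
  | Defs.Seq c1 c2 => cost N c1 + cost N c2
  | If _ c1 c2 => (cost N c1 + cost N c2).+1
  | While _ c1 => (N * (cost N c1).+1).+1
  | _ => 1
  end.

Lemma cost_poly c : exists C d, forall N, 0 < N -> cost N c <= C * N ^ d.
Proof.
elim: c => [|a i e|a i e|c1 [C1 [d1 H1]] c2 [C2 [d2 H2]]
  |b c1 [C1 [d1 H1]] c2 [C2 [d2 H2]]|b c1 [C1 [d1 H1]]] /=.
1-3: by exists 1, 0.
- exists (C1 + C2), (d1 + d2) => N N0; rewrite mulnDl leq_add //.
    by rewrite (leq_trans (H1 _ N0)) // leq_mul2l leq_pexp2l ?orbT ?leq_addr.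
  by rewrite (leq_trans (H2 _ N0)) // leq_mul2l leq_pexp2l ?orbT ?leq_addl.
- exists (C1 + C2).+1, (d1 + d2) => N N0; rewrite mulSn mulnDl -add1n.
  rewrite leq_add ?expn_gt0 ?N0 // leq_add //.
    by rewrite (leq_trans (H1 _ N0)) // leq_mul2l leq_pexp2l ?orbT ?leq_addr.
  by rewrite (leq_trans (H2 _ N0)) // leq_mul2l leq_pexp2l ?orbT ?leq_addl.
- exists C1.+2, d1.+1 => N N0; have := H1 _ N0; rewrite expnS.
  set E := N ^ d1; have E0 : 0 < E by rewrite expn_gt0 N0.
  set x := cost N c1 => Hx.
  have : N * x.+1 <= N * (C1.+1 * E) by rewrite leq_mul2l mulSn; lia.
  have : 0 < N * E by rewrite muln_gt0 N0.
  nia.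
Qed.

Definition run (N : nat) (c : cmd) (m : memory) (Q : memory -> Prop) : Prop :=
  exists t m', [/\ exec c m t m', t <= cost N c & Q m'].

Lemma run_conseq N c m (Q Q' : memory -> Prop) :
  run N c m Q -> (forall m', frame c m m' -> Q m' -> Q' m') -> run N c m Q'.
Proof.
by move=> [t [m' [E le_t Qm']]] QQ'; exists t, m'; split=> //;
  apply: QQ' => //; apply: exec_frame E.
Qed.

Lemma run_seq N c1 c2 m Q :
  run N c1 m (fun m1 => run N c2 m1 Q) -> run N (Defs.Seq c1 c2) m Q.
Proof.
move=> [t1 [m1 [E1 le1 [t2 [m2 [E2 le2 Qm2]]]]]].
by exists (t1 + t2), m2; split=> //; [apply: ExecSeq E1 E2 | rewrite leq_add].
Qed.

Lemma run_skip N m (Q : memory -> Prop) : Q m -> run N Skip m Q.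
Proof. by exists 1, m; split=> //; constructor. Qed.

Lemma run_nset N a i e m (Q : memory -> Prop) :
  Q (Memory (upd (nmem m) a (neval m i) (neval m e)) (wmem m)) ->
  run N (NSet a i e) m Q.
Proof. by move=> H; exists 1; eexists; split; [apply: ExecNSet | | apply: H]. Qed.

Lemma run_wset N a i e m (Q : memory -> Prop) :
  Q (Memory (nmem m) (upd (wmem m) a (neval m i) (weval m e))) ->
  run N (WSet a i e) m Q.
Proof. by move=> H; exists 1; eexists; split; [apply: ExecWSet | | apply: H]. Qed.

Lemma run_if N b c1 c2 m Q :
  (teval m b -> run N c1 m Q) -> (~~ teval m b -> run N c2 m Q) ->
  run N (If b c1 c2) m Q.
Proof.
move=> H1 H2; case Eb: (teval m b).
  have [t [m' [E le_t Qm']]] := H1 Eb; exists t.+1, m'; split=> //.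
    by apply: ExecIf; rewrite Eb.
  by rewrite /= ltnS (leq_trans le_t) ?leq_addr.
have [t [m' [E le_t Qm']]] := H2 (negbT Eb); exists t.+1, m'; split=> //.
  by apply: ExecIf; rewrite Eb.
by rewrite /= ltnS (leq_trans le_t) ?leq_addl.
Qed.

Lemma run_while N b c m (Inv : nat -> memory -> Prop) (Q : memory -> Prop) :
  Inv 0 m ->
  (forall j m', frame c m m' -> Inv j m' -> teval m' b ->
     j < N /\ run N c m' (Inv j.+1)) ->
  (forall j m', frame c m m' -> Inv j m' -> ~~ teval m' b -> Q m') ->
  run N (While b c) m Q.
Proof.
move=> I0 IS IQ.
suff main k : forall j m', N - j <= k -> frame c m m' -> Inv j m' ->
    exists t m'', [/\ exec (While b c) m' t m'',
      t <= ((N - j) * (cost N c).+1).+1 & Q m''].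
  by have [|t [m' [E le_t Qm']]] := main N 0 m _ (same_refl _ _ _) I0;
    [lia | exists t, m'; split=> //; rewrite subn0 in le_t].
elim: k => [|k IHk] j m' le_k F Ij.
  case Eb: (teval m' b); first by have [] := IS _ _ F Ij Eb; lia.
  exists 1, m'; split=> //; first by apply: ExecWhileDone; rewrite Eb.
  exact: IQ F Ij (negbT Eb).
case Eb: (teval m' b); last first.
  exists 1, m'; split=> //; first by apply: ExecWhileDone; rewrite Eb.
  exact: IQ F Ij (negbT Eb).
have [lt_j [t1 [m1 [E1 le1 Ij1]]]] := IS _ _ F Ij Eb.
have F1 := same_trans F (exec_frame E1).
have [|t2 [m2 [E2 le2 Qm2]]] := IHk j.+1 m1 _ F1 Ij1; first lia.
exists (t1 + t2).+1, m2; split=> //; first exact: ExecWhileStep Eb E1 E2.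
have -> : N - j = (N - j.+1).+1 by lia.
rewrite mulSn; lia.
Qed.

Definition cell (x : nat) : nexp := NGet x (NConst 0).
Definition assign (x : nat) (e : nexp) : cmd := NSet x (NConst 0) e.
Definition NLt (e1 e2 : nexp) : test := NLe (NAdd e1 (NConst 1)) e2.

Definition For (x : nat) (e : nexp) (c : cmd) : cmd :=
  Defs.Seq (assign x (NConst 0))
    (While (NLt (cell x) e)
       (Defs.Seq c (assign x (NAdd (cell x) (NConst 1))))).

Definition set_cell (m : memory) (x v : nat) : memory :=
  Memory (upd (nmem m) x 0 v) (wmem m).

Lemma run_for N x e c m lim (Inv : nat -> memory -> Prop) (Q : memory -> Prop) :
  x \notin nwrites c -> lim <= N ->
  (forall m', frame (For x e c) m m' -> neval m' e = lim) ->
  Inv 0 (set_cell m x 0) ->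
  (forall i m', i < lim -> nmem m' x 0 = i -> frame (For x e c) m m' ->
     Inv i m' -> run N c m' (fun m'' => Inv i.+1 (set_cell m'' x i.+1))) ->
  (forall m', frame (For x e c) m m' -> Inv lim m' -> Q m') ->
  run N (For x e c) m Q.
Proof.
move=> xc limN eE I0 IS IQ; apply/run_seq/run_nset => /=.
rewrite -/(set_cell m x 0); set m0 := set_cell m x 0.
have F0 : frame (For x e c) m m0.
  split=> // a; rewrite /= !inE mem_cat negb_or => /andP[/negPf ax _].
  by apply: funext => j; rewrite /m0 /set_cell /upd /= ax.
have Fbody m1 m2 : frame (Defs.Seq c (assign x (NAdd (cell x) (NConst 1)))) m1 m2 ->
    frame (For x e c) m1 m2.
  by apply: same_sub => a //=; rewrite inE => ->; rewrite orbT.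
pose J i m' := [/\ Inv i m', nmem m' x 0 = i & i <= lim].
apply: (@run_while _ _ _ _ J) => [|j m' F [Ij xj lej]|j m' F [Ij xj lej]] /=.
- by split=> //; rewrite /m0 /= /upd !eqxx.
- have {}F := same_trans F0 (Fbody _ _ F).
  rewrite xj eE // addn1 => lt_j; split; first exact: leq_trans lt_j limN.
  apply: run_seq; apply: run_conseq (IS _ _ lt_j xj F Ij) _ => m'' F' Ij'.
  apply: run_nset => /=; rewrite F'.1 // xj addn1.
  by split=> //; rewrite /= /upd !eqxx.
- have {}F := same_trans F0 (Fbody _ _ F).
  rewrite xj eE // addn1 -leqNgt => le_lim; apply: IQ => //.
  by have -> : lim = j by apply/eqP; rewrite eqn_leq le_lim lej.
Qed.

Lemma run_for_ord N n x e c m (J : memory -> Prop) (Phi : 'I_n -> memory -> Prop)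
    (Q : memory -> Prop) :
  x \notin nwrites c -> n <= N ->
  (forall m', frame (For x e c) m m' -> neval m' e = n) ->
  J (set_cell m x 0) ->
  (forall (i : 'I_n) m', nmem m' x 0 = i -> frame (For x e c) m m' -> J m' ->
     run N c m' (fun m'' => let m1 := set_cell m'' x i.+1 in
        [/\ J m1, Phi i m1 & forall i' : 'I_n, i' < i -> Phi i' m' -> Phi i' m1])) ->
  (forall m', frame (For x e c) m m' -> J m' -> (forall i, Phi i m') -> Q m') ->
  run N (For x e c) m Q.
Proof.
move=> xc nN eE J0 JS JQ.
apply: (@run_for _ _ _ _ _ n
  (fun i m' => J m' /\ forall i' : 'I_n, i' < i -> Phi i' m')) => //.
  move=> i m' lt_i xi F [Jm' Pm'].
  apply: run_conseq (JS (Ordinal lt_i) m' xi F Jm') _ => m'' _ [J1 P1 P2].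
  split=> // i'; rewrite ltnS leq_eqVlt => /predU1P[eq_i|lt_i'].
    by have -> : i' = Ordinal lt_i by apply: val_inj.
  exact: P2 (Pm' _ lt_i').
by move=> m' F [Jm' Pm']; apply: JQ => // i; apply: Pm'.
Qed.

Ltac fr F :=
  match type of F with frame _ ?m ?m' =>
    repeat match goal with
    | |- context [nmem m' ?a] => rewrite (proj1 (F : same _ _ m m') a isT)
    | |- context [wmem m' ?a] => rewrite (proj2 (F : same _ _ m m') a isT)
    end;
    try (unfold m; simpl)
  end.

(** * Linear recurring sequences and binary counters *)

Definition lfsr_next (m : nat) (s : seq bool) : bool :=
  \big[addb/false]_(j < m) (nth false s j && nth false s (size s - m + j)).

Fixpoint lfsr (m : nat) (s : seq bool) (k : nat) : seq bool :=
  if k is k'.+1 then rcons (lfsr m s k') (lfsr_next m (lfsr m s k')) else s.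

Definition lbit (m : nat) (s : seq bool) (i : nat) : bool :=
  nth false (lfsr m s i.+1) i.

Lemma size_lfsr m s k : size (lfsr m s k) = size s + k.
Proof. by elim: k => [|k IHk] /=; rewrite ?addn0 // size_rcons IHk addnS. Qed.

Lemma nth_lfsr m s k i : i < size s + k -> nth false (lfsr m s k) i = lbit m s i.
Proof.
have step j : i < size s + j -> nth false (lfsr m s j.+1) i = nth false (lfsr m s j) i.
  by move=> lt_i /=; rewrite nth_rcons size_lfsr lt_i.
have up d j : i < size s + j -> nth false (lfsr m s (j + d)) i = nth false (lfsr m s j) i.
  elim: d => [|d IHd] lt_i; rewrite ?addn0 // addnS step ?IHd //.
  by rewrite (leq_trans lt_i) // leq_add2l leq_addr.
move=> lt_i; rewrite /lbit; case: (leqP k i.+1) => le_k.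
  by rewrite -(subnKC le_k) up.
by rewrite -(subnKC (ltnW le_k)) up // addnS ltnS leq_addl.
Qed.

Lemma lbit_small m s i : i < size s -> lbit m s i = nth false s i.
Proof. by move=> lt_i; rewrite -(@nth_lfsr m s 0) ?addn0. Qed.

Lemma lbit_rec m s i : size s = m + m ->
  lbit m s (m + m + i) =
  \big[addb/false]_(j < m) (lbit m s j && lbit m s (m + i + j)).
Proof.
move=> size_s; rewrite -size_s -(@nth_lfsr m s i.+1) ?addnS //=.
rewrite nth_rcons size_lfsr ltnn eqxx /lfsr_next size_lfsr size_s.
apply: eq_bigr => j _; have lt_j := ltn_ord j.
by rewrite !nth_lfsr ?size_s; [congr (_ && lbit _ _ _)| |]; lia.
Qed.

Lemma ex_lbit m n k (T : {set 'I_n}) (g : 'I_n -> bool) :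
  n * 2 ^ k <= 2 ^ m -> #|T| <= k ->
  exists s : (m + m).-tuple bool, forall v, v \in T -> lbit m s (m + m + v) = g v.
Proof.
move=> le2m leTk; case: (posnP m) => [m0|m_gt0].
  exists [tuple of nseq (m + m) false] => v Tv.
  have n_gt0 : 0 < n by rewrite (leq_ltn_trans _ (ltn_ord v)).
  have k_gt0 : 0 < k by rewrite (leq_trans _ leTk) // (cardD1 v) Tv.
  have : 2 ^ 1 <= 2 ^ k by rewrite leq_exp2l.
  by move: le2m; rewrite m0 expn0 expn1; nia.
have [a [r [rE rT]]] := lin_rec_universal g m_gt0 le2m leTk.
pose s := [tuple (if i < m then a i else r (i - m)) | i < m + m].
have size_s := size_tuple s.
have sE i : i < m + m -> lbit m s i = if i < m then a i else r (i - m).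
  move=> lt_i; rewrite lbit_small ?size_s //.
  by rewrite -[i]/(val (Ordinal lt_i)) -tnth_nth tnth_mktuple.
have lbitE i : lbit m s (m + i) = r i.
  elim/ltn_ind: i => i IHi; case: (ltnP i m) => [lt_i|le_i].
    by rewrite sE ?ltn_add2l // ltnNge leq_addr /= addKn.
  rewrite -(subnKC le_i) addnA lbit_rec // rE; apply: eq_bigr => j _.
  have lt_j := ltn_ord j.
  by rewrite sE ?ltn_addr // lt_j -addnA IHi //; lia.
by exists s => v Tv; rewrite -addnA lbitE rT.
Qed.

Fixpoint bin_val (s : seq bool) : nat :=
  if s is b :: s' then b + (bin_val s').*2 else 0.

Lemma bin_val_lt s : bin_val s < 2 ^ size s.
Proof. by elim: s => //= b s IHs; rewrite expnS; case: b; lia. Qed.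

Lemma bin_val_inj s1 s2 : size s1 = size s2 -> bin_val s1 = bin_val s2 -> s1 = s2.
Proof.
elim: s1 s2 => [|b1 s1 IHs] [|b2 s2] //= [eq_size] eq_val.
have eqb : b1 = b2 by case: b1 b2 eq_val => [] []; lia.
by rewrite eqb (IHs s2) //; move: eq_val; rewrite eqb; lia.
Qed.

Lemma bin_val_all1 i : (bin_val (nseq i true)).+1 = 2 ^ i.
Proof. by elim: i => //= i IHi; rewrite expnS -IHi; lia. Qed.

Lemma bin_val_carry i s :
  bin_val (nseq i false ++ true :: s) = (bin_val (nseq i true ++ false :: s)).+1.
Proof. by elim: i => //= i ->; lia. Qed.

Declare Scope cmd_scope.
Delimit Scope cmd_scope with cmd.
Notation "c1 ;; c2" := (Defs.Seq c1%cmd c2%cmd)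
  (at level 90, right associativity) : cmd_scope.
Notation "x <-- e" := (assign x e) (at level 80) : cmd_scope.

(** * The program *)

Local Notation C := NConst.
Local Notation "'$' x" := (cell x) (at level 5, format "'$' x").
Local Notation "a '@(' i ')'" := (NGet a i) (at level 2, format "a @( i )").
Local Notation "e1 '+:' e2" := (NAdd e1 e2) (at level 50, left associativity).
Local Notation nz e := (NLe (C 1) e).
Local Notation isz e := (NLe e (C 0)).

(* Arrays 0 to 3 hold the input.  [aMul] tabulates the multiples of [n]; [aPair]
   and [aReach] are row-major matrices, as is the array 1 of weights, which holds
   the distances.  The first [2 m] cells of [aTape] are a binary counter, namely the
   coefficients and the first terms of a linear recurrence of order [m]; the bit
   of the vertex [v] is then computed in cell [2 m + v].  Entry [r] of the list of
   partial solutions has its state in [rS], [rV], [rC], [rJ] and its vertex set in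
   [rBits], from position [rBase@(r) = r * n] on.  [cS], [cV], [cC], [cJ] and
   [aCand] hold a candidate entry.  The cells named [40] to [55] are loop counters. *)
Local Notation aHdr := 0 (only parsing).
Local Notation aSrc := 1 (only parsing).
Local Notation aSnk := 2 (only parsing).
Local Notation aAdj := 3 (only parsing).
Local Notation aMul := 4 (only parsing).
Local Notation aPair := 5 (only parsing).
Local Notation aReach := 6 (only parsing).
Local Notation aTape := 7 (only parsing).
Local Notation aCand := 8 (only parsing).
Local Notation rS := 9 (only parsing).
Local Notation rV := 10 (only parsing).
Local Notation rC := 11 (only parsing).
Local Notation rJ := 12 (only parsing).
Local Notation rBase := 13 (only parsing).
Local Notation rBits := 14 (only parsing).
Local Notation xThr := 20 (only parsing).
Local Notation xLog := 21 (only parsing).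
Local Notation xPow := 22 (only parsing).
Local Notation xK := 23 (only parsing).
Local Notation xM := 24 (only parsing).
Local Notation xCnt := 25 (only parsing).
Local Notation xHead := 26 (only parsing).
Local Notation xAns := 27 (only parsing).
Local Notation cS := 30 (only parsing).
Local Notation cV := 31 (only parsing).
Local Notation cC := 32 (only parsing).
Local Notation cJ := 33 (only parsing).
Local Notation xFlag := 34 (only parsing).
Local Notation xGo := 35 (only parsing).
Local Notation xTest := 36 (only parsing).
Local Notation xSub := 37 (only parsing).

Definition eN := aHdr@(C 0).
Definition e2M := $xM +: $xM.
Definition NEq e1 e2 := TAnd (NLe e1 e2) (NLe e2 e1).

Definition gen_cmd : cmd :=
  For 40 eN
    (NSet aTape (e2M +: $40) (C 0) ;;
     For 41 $xM
       (If (TAnd (nz (aTape@($41))) (nz (aTape@($xM +: $40 +: $41))))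
          (NSet aTape (e2M +: $40) (NSub (C 1) (aTape@(e2M +: $40)))) Skip))%cmd.

Definition subset_cmd (a : nat) (base : nexp) : cmd :=
  (xSub <-- C 1 ;;
   For 42 eN
     (If (TAnd (nz (a@(base +: $42))) (isz (aTape@(e2M +: $42))))
        (xSub <-- C 0) Skip))%cmd.

Definition scan_cmd : cmd :=
  For 43 $xCnt
    (If (TAnd (TAnd (NEq (rS@($43)) $cS) (NEq (rV@($43)) $cV))
              (TAnd (NEq (rC@($43)) $cC) (NEq (rJ@($43)) $cJ)))
       (subset_cmd rBits (rBase@($43)) ;;
        If (nz $xSub) (xTest <-- C 0) Skip)
       Skip)%cmd.

Definition incr_cmd : cmd :=
  (44 <-- C 0 ;;
   While (TAnd (NLt $44 e2M) (nz (aTape@($44))))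
     (NSet aTape $44 (C 0) ;; 44 <-- $44 +: C 1) ;;
   If (NLt $44 e2M) (NSet aTape $44 (C 1)) (xGo <-- C 0))%cmd.

Definition fresh_cmd : cmd :=
  (xFlag <-- C 0 ;;
   For 45 e2M (NSet aTape $45 (C 0)) ;;
   xGo <-- C 1 ;;
   While (nz $xGo)
     (gen_cmd ;;
      subset_cmd aCand (C 0) ;;
      xTest <-- $xSub ;;
      scan_cmd ;;
      If (nz $xTest) (xFlag <-- C 1) Skip ;;
      incr_cmd))%cmd.

Definition append_cmd : cmd :=
  (NSet rS $xCnt $cS ;; NSet rV $xCnt $cV ;;
   NSet rC $xCnt $cC ;; NSet rJ $xCnt $cJ ;;
   For 46 eN (NSet rBits (rBase@($xCnt) +: $46) (aCand@($46))) ;;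
   NSet rBase ($xCnt +: C 1) (rBase@($xCnt) +: eN) ;;
   xCnt <-- $xCnt +: C 1)%cmd.

Definition add_cmd : cmd := (fresh_cmd ;; If (nz $xFlag) append_cmd Skip)%cmd.

Definition source_expr := rS@($xHead).
Definition end_expr := rV@($xHead).
Definition closed_test : test := nz (aPair@(aMul@(source_expr) +: end_expr)).
Definition step_test : test :=
  TAnd (TAnd (nz (aAdj@(aMul@(end_expr) +: $47))) (nz (aReach@(aMul@(source_expr) +: end_expr))))
    (WLe (WAdd (WGet 1 (aMul@(source_expr) +: end_expr)) (WGet 0 (aMul@(end_expr) +: $47)))
       (WGet 1 (aMul@(source_expr) +: $47))).

Definition expand_cmd : cmd :=
  For 47 eN
    (If (isz (rBits@(rBase@($xHead) +: $47)))
       (For 48 eN (NSet aCand $48 (rBits@(rBase@($xHead) +: $48))) ;;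
        NSet aCand $47 (C 1) ;;
        cJ <-- rJ@($xHead) +: C 1 ;;
        cV <-- $47 ;;
        If closed_test
          (cS <-- $47 ;; cC <-- rC@($xHead) +: C 1 ;; add_cmd) Skip ;;
        If step_test
          (cS <-- source_expr ;; cC <-- rC@($xHead) ;; add_cmd) Skip)
       Skip)%cmd.

(* The vertex [n] does not exist: the first entry stands for a path from [n] to
   [n], which can be closed because of the last command of [prelude_cmd]. *)
Definition search_cmd : cmd :=
  (xM <-- $xLog +: $xK ;;
   NSet rS (C 0) eN ;; NSet rV (C 0) eN ;; NSet rC (C 0) (C 0) ;; NSet rJ (C 0) (C 0) ;;
   For 49 eN (NSet rBits $49 (C 0)) ;;
   NSet rBase (C 0) (C 0) ;;
   NSet rBase (C 1) eN ;;
   xCnt <-- C 1 ;;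
   xHead <-- C 0 ;;
   While (NLt $xHead $xCnt)
     (If (TAnd closed_test (NLe $xThr (rC@($xHead)))) (xAns <-- C 1) Skip ;;
      If (NLt (rJ@($xHead)) $xK) expand_cmd Skip ;;
      xHead <-- $xHead +: C 1))%cmd.

Definition prelude_cmd : cmd :=
  (If (nz (aHdr@(C 2))) Skip (xThr <-- aHdr@(C 3)) ;;
   For 50 eN (NSet aMul ($50 +: C 1) (aMul@($50) +: eN)) ;;
   xPow <-- C 1 ;;
   While (NLt $xPow eN) (xPow <-- $xPow +: $xPow ;; xLog <-- $xLog +: C 1) ;;
   NSet aPair (aMul@(eN) +: eN) (C 1))%cmd.

Definition pairs_cmd : cmd :=
  For 51 (aHdr@(C 1))
    (NSet aPair (aMul@(aSrc@($51) ) +: aSnk@($51)) (C 1)).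

Definition relax_cmd : cmd :=
  If (TAnd (TAnd (nz (aAdj@(aMul@($54) +: $55))) (nz (aReach@(aMul@($53) +: $54))))
       (TNot (TAnd (nz (aReach@(aMul@($53) +: $55)))
          (WLe (WGet 1 (aMul@($53) +: $55))
             (WAdd (WGet 1 (aMul@($53) +: $54)) (WGet 0 (aMul@($54) +: $55)))))))
    (NSet aReach (aMul@($53) +: $55) (C 1) ;;
     WSet 1 (aMul@($53) +: $55)
       (WAdd (WGet 1 (aMul@($53) +: $54)) (WGet 0 (aMul@($54) +: $55))))%cmd Skip.

Definition distances_cmd : cmd :=
  (For 52 eN (NSet aReach (aMul@($52) +: $52) (C 1)) ;;
   For 52 eN (For 53 eN (For 54 eN (For 55 eN relax_cmd))))%cmd.

Definition main_cmd : cmd :=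
  (While (TAnd (isz $xAns) (NLe $xK eN)) (search_cmd ;; xK <-- $xK +: C 1) ;;
   NSet aHdr (C 0) $xAns)%cmd.

Definition mvdsp_cmd : cmd :=
  (prelude_cmd ;; pairs_cmd ;; distances_cmd ;; main_cmd)%cmd.

(** * Representative families *)

Lemma run_gen N n k s m :
  nmem m aHdr 0 = n -> nmem m xM 0 = k -> n <= N -> k <= N ->
  size s = k + k -> (forall i, i < k + k -> nmem m aTape i = lbit k s i) ->
  run N gen_cmd m
    (fun m' => forall i, i < k + k + n -> nmem m' aTape i = lbit k s i).
Proof.
move=> mn mk nN kN size_s mt.
apply: (@run_for _ _ _ _ _ n
  (fun i m' => forall i', i' < k + k + i -> nmem m' aTape i' = lbit k s i')) => //.
- by move=> m' F /=; fr F.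
- by move=> i; rewrite addn0 => /mt.
move=> i m' lt_i xi F Im'; apply/run_seq/run_nset => /=.
have mk' : nmem m' xM 0 = k by fr F.
rewrite xi mk'.
set m1 := Memory _ _.
pose xor j := \big[addb/false]_(j' < j) (lbit k s j' && lbit k s (k + i + j')).
apply: (@run_for _ _ _ _ _ k
  (fun j m2 => (forall i', i' < k + k + i -> nmem m2 aTape i' = lbit k s i') /\
      nmem m2 aTape (k + k + i) = xor j)) => //.
- by move=> m2 F2 /=; fr F2.
- split=> [i' lt_i'|] /=; rewrite /upd /= ?eqxx //.
    by rewrite ltn_eqF // Im'.
  by rewrite /xor big_ord0.
- move=> j m2 lt_j xj F2 [I2 X2].
  have m2k : nmem m2 xM 0 = k by fr F2.
  have m2i : nmem m2 40 0 = i by fr F2.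
  apply: run_if => /=; rewrite m2k m2i xj !I2 ?lt0b; try lia.
    case/andP=> bj bij; apply: run_nset => /=. rewrite m2k m2i X2 /xor big_ord_recr /=.
    rewrite bj bij /upd /= eqxx; split=> [i' lt_i'|].
      by rewrite ltn_eqF // I2.
    by case: (\big[_/_]_(_ < _) _).
  move=> b0; apply: run_skip; split=> [//|]; rewrite /xor big_ord_recr /= X2 /xor.
  by rewrite -(negbK (_ && _)) b0 addbF.
- move=> m2 F2 [I2 X2] i' /=; rewrite addnS ltnS leq_eqVlt => /predU1P[->|/I2] //.
  by rewrite X2 lbit_rec.
Qed.

Definition lfsr_set (n k : nat) (s : seq bool) : {set 'I_n} :=
  [set v : 'I_n | lbit k s (k + k + v)].

Lemma run_subset N n k s a b base (A : {set 'I_n}) m :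
  a != xSub -> a != 42 -> nmem m aHdr 0 = n -> nmem m xM 0 = k -> n <= N ->
  (forall m', frame (subset_cmd a base) m m' -> neval m' base = b) ->
  (forall v : 'I_n, nmem m a (b + v) = (v \in A)) ->
  (forall v : 'I_n, nmem m aTape (k + k + v) = lbit k s (k + k + v)) ->
  run N (subset_cmd a base) m
    (fun m' => nmem m' xSub 0 = (A \subset lfsr_set n k s)).
Proof.
move=> aSub a42 mn mk nN bE Am tm; apply/run_seq/run_nset => /=.
set m1 := Memory _ _.
apply: (@run_for _ _ _ _ _ n (fun i m2 => nmem m2 xSub 0 =
  [forall v : 'I_n, (v < i) && (v \in A) ==> (v \in lfsr_set n k s)])) => //.
- by move=> m2 F /=; fr F.
- by rewrite /=; case: forallP => // -[].
- move=> i m2 lt_i xi F I2.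
  have m2k : nmem m2 xM 0 = k by fr F.
  have F1 : frame (subset_cmd a base) m m1.
    split=> // a' /=; rewrite inE => /norP[/negPf a'S _].
    by apply: funext => j; rewrite /m1 /= a'S.
  have F2 : frame (subset_cmd a base) m m2.
    apply: same_trans F1 _; apply: same_sub F => [a' a'P|//].
    by move: a'P; rewrite /= !inE => ->; rewrite orbT.
  have m2a : nmem m2 a = nmem m a.
    by rewrite (F2.1 a) //= !inE (negPf aSub) (negPf a42).
  have m2t : nmem m2 aTape = nmem m aTape by fr F2.
  pose u := Ordinal lt_i.
  have stepE : [forall v : 'I_n, (v < i.+1) && (v \in A) ==> (v \in lfsr_set n k s)] =
      [forall v : 'I_n, (v < i) && (v \in A) ==> (v \in lfsr_set n k s)] &&
        ((u \in A) ==> (u \in lfsr_set n k s)).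
    apply/forallP/andP => [H | [/forallP H Hu] v].
      split; last by have := H u; rewrite ltnSn.
      apply/forallP => v; apply/implyP => /andP[lt_v Av]; apply: (implyP (H v)).
      by rewrite Av ltnW.
    apply/implyP => /andP[]; rewrite ltnS leq_eqVlt => /predU1P[eq_v | lt_v] Av.
      by have eq_vu : v = u by [apply: val_inj]; move: Hu; rewrite -eq_vu Av.
    by apply: (implyP (H v)); rewrite lt_v.
  apply: run_if => /=; rewrite (bE _ F2) m2k xi m2a m2t (Am u) (tm u) lt0b leqn0 eqb0.
    case/andP=> Au uS; apply: run_nset => /=.
    by rewrite stepE Au inE (negPf uS) andbF.
  move=> H; apply: run_skip => /=; rewrite I2 stepE inE.
  by move: H; rewrite negb_and negbK => H; rewrite [(u \in A) ==> _]implybE H andbT.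
- move=> m2 F /= ->; congr nat_of_bool; apply/forallP/subsetP => [H v Av | H v].
    by apply: (implyP (H v)); rewrite ltn_ord.
  by apply/implyP => /andP[_ /H].
Qed.

Lemma run_incr N k (t : (k + k).-tuple bool) m :
  nmem m xM 0 = k -> k + k <= N -> nmem m xGo 0 = 1 ->
  (forall i, i < k + k -> nmem m aTape i = nth false t i) ->
  run N incr_cmd m (fun m' =>
    (nmem m' xGo 0 = 0 /\ (bin_val t).+1 = 2 ^ (k + k)) \/
    (nmem m' xGo 0 = 1 /\ exists2 t' : (k + k).-tuple bool,
       bin_val t' = (bin_val t).+1 &
       forall i, i < k + k -> nmem m' aTape i = nth false t' i)).
Proof.
move=> mk kN mgo mt; apply/run_seq/run_nset => /=; set m1 := Memory _ _.
have size_t := size_tuple t.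
apply/run_seq/(@run_while _ _ _ _ (fun j m2 => [/\ nmem m2 44 0 = j, j <= k + k,
   forall i, i < k + k -> nmem m2 aTape i = (j <= i) && nth false t i &
   forall i, i < j -> nth false t i])).
- by split.
- move=> j m2 F [xj le_j I2 I3] /=.
  have m2k : nmem m2 xM 0 = k by fr F.
  rewrite xj m2k addn1 => /andP[lt_j]; rewrite I2 // leqnn lt0b /= => tj.
  split; first exact: leq_trans lt_j kN.
  apply/run_seq/run_nset/run_nset => /=; rewrite xj addn1; split=> // i lt_i.
    by case: (eqVneq i j) => [->|ne_ij]; rewrite ?ltnn // I2 // ltn_neqAle eq_sym ne_ij.
  by move: lt_i; rewrite ltnS leq_eqVlt => /predU1P[->|/I3].
- move=> j m2 F [xj le_j I2 I3] /=.
  have m2k : nmem m2 xM 0 = k by fr F.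
  have m2go : nmem m2 xGo 0 = 1 by fr F.
  rewrite xj m2k addn1 => jP.
  have tE : t = nseq j true ++ drop j t :> seq bool.
    rewrite -{1}(cat_take_drop j t); congr (_ ++ _).
    have size_j : size (take j t) = j by rewrite size_takel ?size_t.
    apply: (@eq_from_nth _ false); rewrite ?size_nseq // size_j => i lt_i.
    by rewrite nth_take // nth_nseq lt_i I3.
  apply: run_if => /=; rewrite xj m2k addn1 => lt_j; apply: run_nset => /=.
    have tj : nth false t j = false.
      by apply/negbTE; move: jP; rewrite lt_j I2 // leqnn lt0b.
    rewrite (drop_nth false) ?size_t // tj in tE.
    have size_t' : size (nseq j false ++ true :: drop j.+1 t) == k + k.
      by rewrite size_cat size_nseq /= size_drop size_t; lia.
    right; split=> //; exists (Tuple size_t'); first by rewrite /= bin_val_carry -tE.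
    move=> i lt_i /=; rewrite xj nth_cat size_nseq nth_nseq.
    case: (ltngtP i j) => [lt_ij|gt_ij|->]; last by rewrite subnn.
      by rewrite I2 // leqNgt lt_ij.
    rewrite I2 // (ltnW gt_ij) /= -(subnKC gt_ij) -nth_drop.
    by have -> : j.+1 + (i - j.+1) - j = (i - j.+1).+1 by lia.
  have eq_j : j = k + k by apply/eqP; rewrite eqn_leq le_j leqNgt.
  left; split=> //; rewrite tE drop_oversize ?size_t ?eq_j // cats0.
  exact: bin_val_all1.
Qed.

(* A state is the source and the current end of the path under construction, the
   number of paths closed before it and the number of vertices used so far. *)
Definition state := (nat * nat * nat * nat)%type.
Definition entry (n : nat) := (state * {set 'I_n})%type.
Definition entry0 n : entry n := (0, 0, 0, 0, set0).

Definition stored n m r (e : entry n) : Prop :=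
  let: (s, v, c, j, A) := e in
  [/\ nmem m rS r = s, nmem m rV r = v, nmem m rC r = c, nmem m rJ r = j
    & forall u : 'I_n, nmem m rBits (r * n + u) = (u \in A)].

Definition stores n m (L : seq (entry n)) : Prop :=
  [/\ nmem m xCnt 0 = size L,
      forall r, r <= size L -> nmem m rBase r = r * n
    & forall r, r < size L -> stored m r (nth (entry0 n) L r)].

Definition candidate n m (e : entry n) : Prop :=
  let: (s, v, c, j, A) := e in
  [/\ nmem m cS 0 = s, nmem m cV 0 = v, nmem m cC 0 = c, nmem m cJ 0 = j
    & forall u : 'I_n, nmem m aCand u = (u \in A)].

Definition same_list_arrays (m m' : memory) : Prop :=
  [/\ nmem m' xCnt = nmem m xCnt, nmem m' rBase = nmem m rBase,
      nmem m' rBits = nmem m rBits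
    & [/\ nmem m' rS = nmem m rS, nmem m' rV = nmem m rV,
          nmem m' rC = nmem m rC & nmem m' rJ = nmem m rJ]].

Lemma stores_same n m m' (L : seq (entry n)) :
  same_list_arrays m m' -> stores m L -> stores m' L.
Proof.
by move=> [eC eB eb [eS eV eCl eJ]]; rewrite /stores /stored eC eB eb eS eV eCl eJ.
Qed.

Lemma candidate_same n m m' (e : entry n) :
  [/\ nmem m' cS = nmem m cS, nmem m' cV = nmem m cV, nmem m' cC = nmem m cC,
      nmem m' cJ = nmem m cJ & nmem m' aCand = nmem m aCand] ->
  candidate m e -> candidate m' e.
Proof. by move=> [eS eV eC eJ eA]; rewrite /candidate eS eV eC eJ eA. Qed.

Definition hits n k (q : state) (t : seq bool) (e : entry n) : bool :=
  (e.1 == q) && (e.2 \subset lfsr_set n k t).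

Lemma run_scan N n k s (L : seq (entry n)) (e : entry n) (b0 : bool) m :
  nmem m aHdr 0 = n -> nmem m xM 0 = k -> n <= N -> size L <= N ->
  stores m L -> candidate m e -> nmem m xTest 0 = b0 ->
  (forall v : 'I_n, nmem m aTape (k + k + v) = lbit k s (k + k + v)) ->
  run N scan_cmd m
    (fun m' => nmem m' xTest 0 = b0 && all (fun f => ~~ hits k e.1 s f) L).
Proof.
move: e => [[[[s2 v2] c2] j2] A2]; set e := (_, _) => mn mk nN LN mL me mb mt.
apply: (@run_for _ _ _ _ _ (size L) (fun i m2 => nmem m2 xTest 0 =
  b0 && all (fun f => ~~ hits k e.1 s f) (take i L))) => //.
- by move=> m2 F /=; fr F; case: mL.
- by rewrite take0 andbT.
- move=> r m2 lt_r xr F I2.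
  have m2L : stores m2 L by apply: stores_same mL; split; [..|split]; fr F.
  have m2e : candidate m2 e.
    by apply: candidate_same me; split; fr F.
  have m2k : nmem m2 xM 0 = k by fr F.
  have m2n : nmem m2 aHdr 0 = n by fr F.
  have m2t : nmem m2 aTape = nmem m aTape by fr F.
  have m2b : nmem m2 rBase r = r * n by have [_ ->] := m2L; rewrite // ltnW.
  have [_ _ /(_ r lt_r)] := m2L.
  rewrite (take_nth (entry0 n)) // all_rcons.
  set f := nth _ L r; set a := all _ _ in I2 *.
  case: f => [[[[s1 v1] c1] j1] A1] /= [fS fV fC fJ fA].
  have [eS eV eC eJ eA] := m2e.
  set q1 := (s1, v1, c1, j1); set q2 := (s2, v2, c2, j2).
  have testE : (s1 <= s2 <= s1) && (v1 <= v2 <= v1) && ((c1 <= c2 <= c1) && (j1 <= j2 <= j1)) =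
      (q1 == q2).
    by rewrite -!eqn_leq /q1 /q2 !xpair_eqE -!andbA.
  apply: run_if => /=; rewrite xr ?fS fV fC fJ eS eV eC eJ testE => q12.
    apply: run_seq; apply: run_conseq (@run_subset N n k s rBits (r * n) _ A1 m2 _ _ _ _ _ _ _ _) _ => //.
    + by move=> m3 F3 /=; fr F3; rewrite xr.
    + by move=> v; rewrite m2t.
    move=> m3 F3 sub3; have m3I : nmem m3 xTest 0 = b0 && a by fr F3.
    apply: run_if => /=; rewrite sub3 lt0b => subA; [apply: run_nset | apply: run_skip] => /=.
      by rewrite /hits /= q12 subA andbF.
    by rewrite /hits /= q12 (negPf subA) m3I.
  by apply: run_skip => /=; rewrite I2 /hits /= (negPf q12).
- by move=> m2 F; rewrite take_size.
Qed.

Definition fresh n k (L : seq (entry n)) (e : entry n) (t : seq bool) : bool :=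
  (e.2 \subset lfsr_set n k t) && all (fun f => ~~ hits k e.1 t f) L.

Lemma run_fresh N n k (L : seq (entry n)) (e : entry n) m :
  nmem m aHdr 0 = n -> nmem m xM 0 = k -> n <= N -> 2 ^ (k + k) <= N -> size L <= N ->
  stores m L -> candidate m e ->
  run N fresh_cmd m (fun m' => nmem m' xFlag 0 =
    [exists t : (k + k).-tuple bool, fresh k L e t]).
Proof.
move=> mn mk nN kN LN mL me.
have kkN : k + k <= N by apply: leq_trans kN; rewrite ltnW // ltn_expl.
have kN' : k <= N by apply: leq_trans kkN; rewrite leq_addr.
apply/run_seq/run_nset => /=; set m1 := Memory _ _.
apply/run_seq/(@run_for _ _ _ _ _ (k + k)
  (fun i m2 => forall i', i' < i -> nmem m2 aTape i' = 0)) => //.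
- by move=> m2 F /=; fr F; rewrite /= mk.
- move=> i m2 lt_i xi F I2; apply: run_nset => /= i'; rewrite xi ltnS leq_eqVlt.
  by case: eqP => //= _; apply: I2.
move=> m2 F2 I2; apply/run_seq/run_nset => /=; set m3 := Memory _ _.
pose some_fresh x := [exists t : (k + k).-tuple bool, (bin_val t < x) && fresh k L e t].
apply: (@run_while _ _ _ _ (fun x m4 =>
  (nmem m4 xGo 0 = 0 /\ nmem m4 xFlag 0 = some_fresh (2 ^ (k + k))) \/
  [/\ nmem m4 xGo 0 = 1, nmem m4 xFlag 0 = some_fresh x &
    exists2 t : (k + k).-tuple bool, bin_val t = x &
      forall i, i < k + k -> nmem m4 aTape i = nth false t i])).
- right; split=> //=.
    fr F2; have -> // : some_fresh 0 = false.
    by apply/negbTE/negP => /existsP[].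
  exists [tuple of nseq (k + k) false] => [|i lt_i]; first by elim: (k + k) => //= ? ->.
  by rewrite I2 // nth_nseq lt_i.
- move=> x m4 F4 I4 /= go4; case: I4 => [[go0 _]|[go1 flag4 [t valt tape4]]].
    by rewrite go0 in go4.
  have size_t := size_tuple t.
  split; first by rewrite -valt (leq_trans _ kN) //; have := bin_val_lt t; rewrite size_t.
  have m4n : nmem m4 aHdr 0 = n by fr F4; fr F2.
  have m4k : nmem m4 xM 0 = k by fr F4; fr F2.
  have m4L : stores m4 L.
    by apply: stores_same mL; split; [..|split]; fr F4; rewrite /=; fr F2.
  have m4e : candidate m4 e.
    by apply: candidate_same me; split; fr F4; rewrite /=; fr F2.
  apply: run_seq; apply: run_conseq (@run_gen N n k t m4 _ _ _ _ _ _) _ => //.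
    by move=> i lt_i; rewrite tape4 // lbit_small // size_t.
  move=> m5 F5 tape5; apply: run_seq.
  have m5L : stores m5 L by apply: stores_same m4L; split; [..|split]; fr F5.
  have m5e : candidate m5 e.
    by apply: candidate_same m4e; split; fr F5.
  apply: run_conseq (@run_subset N n k t aCand 0 _ e.2 m5 _ _ _ _ _ _ _ _) _ => //.
  + by fr F5.
  + by fr F5.
  + by move=> v; case: e {me I2 some_fresh flag4 m4e} m5e => [[[[? ?] ?] ?] ?] /= []; rewrite add0n.
  + by move=> v; rewrite tape5 // ltn_add2l.
  move=> m6 F6 sub6; apply/run_seq/run_nset => /=; set m7 := Memory _ _; apply: run_seq.
  apply: run_conseq (@run_scan N n k t L e (e.2 \subset lfsr_set n k t) m7 _ _ _ _ _ _ _ _) _ => //=.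
  + by fr F6; fr F5.
  + by fr F6; fr F5.
  + by apply: stores_same m5L; split; [..|split] => /=; fr F6.
  + by apply: candidate_same m5e; split=> /=; fr F6.
  + by move=> v; fr F6; rewrite tape5 // ltn_add2l.
  move=> m8 F8; rewrite -/(fresh k L e t) => test8; apply: run_seq.
  have someE : some_fresh x.+1 = some_fresh x || fresh k L e t.
    apply/existsP/orP => [[t' /andP[]]|[/existsP[t' /andP[lt_t' ft']]|ft]].
    - rewrite ltnS leq_eqVlt => /predU1P[eq_t|lt_t'] ft'; last first.
        by left; apply/existsP; exists t'; rewrite lt_t'.
      right; suff <- : t' = t :> seq bool by [].
      by apply: bin_val_inj; rewrite ?size_tuple // eq_t.
    - by exists t'; rewrite ft' ltnW.
    - by exists t; rewrite ft valt ltnSn.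
  have flag8 : nmem m8 xFlag 0 = some_fresh x by fr F8; rewrite /=; fr F6; fr F5.
  apply: (@run_conseq _ _ _ (fun m9 => frame (If (nz $xTest) (xFlag <-- C 1) Skip)%cmd m8 m9 /\
     nmem m9 xFlag 0 = some_fresh x.+1)).
    apply: (run_conseq (Q := fun m9 => nmem m9 xFlag 0 = some_fresh x.+1)) => //.
    apply: run_if => /=; rewrite test8 lt0b => ft; [apply: run_nset | apply: run_skip] => /=.
      by rewrite someE ft orbT.
    by rewrite someE (negPf ft) orbF.
  move=> m9 _ [F9 flag9].
  apply: run_conseq (@run_incr N k t m9 _ _ _ _) _ => //.
  + by fr F9; fr F8; rewrite /=; fr F6; fr F5.
  + by fr F9; fr F8; fr F6; fr F5.
  + move=> i lt_i; fr F9; fr F8; fr F6.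
    by rewrite tape5; [rewrite lbit_small ?size_t | apply: ltn_addr].
  move=> m10 F10 [[go10 valE]|[go10 [t' valt' tape10]]]; [left|right].
    by split=> //; fr F10; rewrite flag9 -valt valE.
  by split=> //; [fr F10 | exists t'; rewrite // valt' valt].
- move=> x m4 F4 [[_ flag4] _|[go4 _ _]]; last by rewrite /= go4.
  rewrite flag4; congr nat_of_bool; apply: eq_existsb => t.
  by have := bin_val_lt t; rewrite size_tuple => ->.
Qed.

Lemma run_append N n (L : seq (entry n)) (e : entry n) m :
  nmem m aHdr 0 = n -> n <= N -> stores m L -> candidate m e ->
  run N append_cmd m (fun m' => stores m' (rcons L e)).
Proof.
move: e => [[[[s v] c] j] A] mn nN [mc mb mL] [eS eV eC eJ eA].
do 4![apply/run_seq/run_nset => /=]; rewrite mc eS eV eC eJ; set m1 := Memory _ _.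
have bn : nmem m rBase (size L) = size L * n by apply: mb.
apply/run_seq/(@run_for _ _ _ _ _ n (fun i m2 =>
  (forall r (u : 'I_n), r < size L -> nmem m2 rBits (r * n + u) = nmem m rBits (r * n + u)) /\
  (forall u : 'I_n, u < i -> nmem m2 rBits (size L * n + u) = (u \in A)))) => //.
- by move=> m2 F /=; fr F.
- move=> i m2 lt_i xi F [I2 I3]; apply: run_nset => /=.
  have m2c : nmem m2 xCnt 0 = size L by fr F.
  have m2b : nmem m2 rBase (size L) = size L * n by fr F.
  have m2A : nmem m2 aCand i = (Ordinal lt_i \in A) by fr F; rewrite (eA (Ordinal lt_i)).
  rewrite m2c m2b xi m2A; split=> [r u lt_r | u].
    have lt_u := ltn_ord u; rewrite ifN ?I2 //; nia.
  rewrite ltnS leq_eqVlt eqn_add2l => /predU1P[eq_u | lt_u].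
    by rewrite eq_u eqxx (_ : Ordinal lt_i = u) //; apply: val_inj.
  by rewrite ltn_eqF // I3.
move=> m2 F [I2 I3]; apply/run_seq/run_nset/run_nset => /=; fr F.
rewrite mc addn1; split=> [|r|r]; rewrite /= ?size_rcons ?eqxx //.
  by rewrite leq_eqVlt => /predU1P[->|lt_r]; rewrite ?eqxx ?bn ?mn ?mulSn 1?addnC //;
     rewrite ltn_eqF //; fr F; apply: mb.
rewrite ltnS leq_eqVlt nth_rcons => /predU1P[->|lt_r].
  by rewrite ltnn eqxx; split=> [||||u] /=; fr F; rewrite ?eqxx //; apply: I3.
rewrite lt_r; have := mL r lt_r; case: nth => [[[[s1 v1] c1] j1] A1] /= [H1 H2 H3 H4 H5].
by split=> [||||u] /=; fr F; rewrite ?(ltn_eqF lt_r) // I2.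
Qed.

Definition add_entry n k (L : seq (entry n)) (e : entry n) : seq (entry n) :=
  if [exists t : (k + k).-tuple bool, fresh k L e t] then rcons L e else L.

Lemma run_add N n k (L : seq (entry n)) (e : entry n) m :
  nmem m aHdr 0 = n -> nmem m xM 0 = k -> n <= N -> 2 ^ (k + k) <= N -> size L <= N ->
  stores m L -> candidate m e ->
  run N add_cmd m (fun m' => stores m' (add_entry k L e)).
Proof.
move=> mn mk nN kN LN mL me; apply: run_seq.
apply: run_conseq (run_fresh mn mk nN kN LN mL me) _ => m1 F1 flag1.
have m1L : stores m1 L by apply: stores_same mL; split; [..|split]; fr F1.
have m1e : candidate m1 e by apply: candidate_same me; split; fr F1.
apply: run_if => /=; rewrite flag1 lt0b /add_entry => fe.
  by rewrite fe; apply: run_append => //; fr F1.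
by rewrite (negPf fe); apply: run_skip.
Qed.

(** * The abstract search *)

Definition succs (close : nat -> nat -> bool) (step : nat -> nat -> nat -> bool)
    (q : state) (u : nat) : seq state :=
  let: (s, v, c, j) := q in
  (if close s v then [:: (u, u, c.+1, j.+1)] else [::]) ++
  (if step s v u then [:: (s, u, c, j.+1)] else [::]).

Definition state0 n : state := (n, n, 0, 0).

Inductive reached n (succ : state -> nat -> seq state) :
    state -> {set 'I_n} -> Prop :=
| Reached0 : reached succ (state0 n) set0
| ReachedS q A (u : 'I_n) q' :
    reached succ q A -> u \notin A -> q' \in succ q u -> reached succ q' (u |: A).

Lemma reached_bounds n close step s v c j (A : {set 'I_n}) :
  reached (succs close step) (s, v, c, j) A ->
  [/\ s <= n, v <= n, c <= j & j = #|A|].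
Proof.
move eq_q : (s, v, c, j) => q rA.
elim: rA s v c j eq_q => {q A} [|[[[s v] c] j] A u q' _ IH uA q'P] s' v' c' j' eq_q.
  by case: eq_q => -> -> -> ->; rewrite cards0.
have [les lev lec jE] := IH _ _ _ _ erefl; have leu := ltnW (ltn_ord u).
move: q'P; rewrite -eq_q /= mem_cat cardsU1 uA -jE.
case: close => /=; case: step; rewrite ?inE ?orbF //.
- by case/orP => /eqP[-> -> -> ->]; split; lia.
- by case/eqP => -> -> -> ->; split; lia.
- by case/eqP => -> -> -> ->; split; lia.
Qed.

Definition covered n k (L : seq (entry n)) (e : entry n) : bool :=
  ~~ [exists t : (k + k).-tuple bool, fresh k L e t].

Lemma coveredP n k (L : seq (entry n)) (e : entry n) (t : (k + k).-tuple bool) :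
  covered k L e -> e.2 \subset lfsr_set n k t -> exists2 f, f \in L & hits k e.1 t f.
Proof.
rewrite /covered negb_exists => /forallP/(_ t); rewrite /fresh => + eT.
by rewrite eT /= -has_predC => /hasP[f fL]; rewrite /= negbK => fh; exists f.
Qed.

Lemma covered_sub n k (L L' : seq (entry n)) (e : entry n) :
  {subset L <= L'} -> covered k L e -> covered k L' e.
Proof.
move=> sL; apply: contra => /existsP[t /andP[et /allP aL]].
by apply/existsP; exists t; rewrite /fresh et; apply/allP => f /sL/aL.
Qed.

Lemma covered_add n k (L : seq (entry n)) (e : entry n) :
  covered k (add_entry k L e) e.
Proof.
rewrite /add_entry; case: ifPn => // _; apply/existsP => -[t /andP[et]].
by rewrite all_rcons /hits eqxx et.
Qed.

Lemma add_entry_sub n k (L : seq (entry n)) (e : entry n) :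
  exists L', add_entry k L e = L ++ L'.
Proof.
rewrite /add_entry; case: ifP => _; last by exists [::]; rewrite cats0.
by exists [:: e]; rewrite cats1.
Qed.

Definition chained n k (L : seq (entry n)) : Prop :=
  forall r, r < size L -> exists t : (k + k).-tuple bool,
    fresh k (take r L) (nth (entry0 n) L r) t.

Lemma chained_add n k (L : seq (entry n)) (e : entry n) :
  chained k L -> chained k (add_entry k L e).
Proof.
move=> cL; rewrite /add_entry; case: ifP => // /existsP[t ft] r.
rewrite size_rcons ltnS => le_r; rewrite nth_rcons -cats1 takel_cat //.
move: le_r; rewrite leq_eqVlt => /predU1P[->|lt_r]; last by rewrite lt_r; apply: cL.
by rewrite ltnn eqxx take_size; exists t.
Qed.

Section AbstractSearch.

Variables (n k : nat) (close : nat -> nat -> bool) (step : nat -> nat -> nat -> bool).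
Let succ := succs close step.

Definition good (L : seq (entry n)) : Prop :=
  (forall e, e \in L -> reached succ e.1 e.2) /\ chained k L.

Lemma good_add (L : seq (entry n)) (e : entry n) (u : 'I_n) q :
  good L -> e \in L -> u \notin e.2 -> q \in succ e.1 u ->
  good (add_entry k L (q, u |: e.2)).
Proof.
move=> [rL cL] eL ue qe; split; last exact: chained_add.
rewrite /add_entry; case: ifP => // _ f; rewrite mem_rcons inE => /predU1P[->|/rL//].
exact: ReachedS (rL _ eL) ue qe.
Qed.

Lemma good_single : good [:: (state0 n, set0)].
Proof.
split=> [e|[|//] _]; first by rewrite inE => /eqP->; apply: Reached0.
by exists [tuple of nseq (k + k) false]; rewrite /fresh /= sub0set.
Qed.

(* The states and the witnesses of freshness of the entries are distinct. *)
Lemma good_size (L : seq (entry n)) : good L -> size L <= n.+1 ^ 4 * 2 ^ (k + k).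
Proof.
move=> [rL cL].
pose box := ('I_n.+1 * 'I_n.+1 * 'I_n.+1 * 'I_n.+1)%type.
pose boxed (q : state) : box :=
  let: (s, v, c, j) := q in (inord s, inord v, inord c, inord j).
have boxedK e f : e \in L -> f \in L -> boxed e.1 = boxed f.1 -> e.1 = f.1.
  have bounds (g : entry n) : g \in L -> let: (s, v, c, j) := g.1 in
      [/\ s < n.+1, v < n.+1, c < n.+1 & j < n.+1].
    case: g => [[[[s v] c] j] A] /rL/reached_bounds[/= les lev lec jE].
    have lej : j <= n by rewrite jE -[n in _ <= n]card_ord max_card.
    by rewrite !ltnS; split=> //; apply: leq_trans lej.
  case: e f => [[[[s v] c] j] A] [[[[s' v'] c'] j'] A'].
  move=> /bounds /= [? ? ? ?] /bounds /= [? ? ? ?] [].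
  move=> /(congr1 val) + /(congr1 val) + /(congr1 val) + /(congr1 val).
  by rewrite /= !inordK // => -> -> -> ->.
have {}cL (r : 'I_(size L)) : {t : (k + k).-tuple bool |
    fresh k (take r L) (nth (entry0 n) L r) t}.
  by apply: sigW; apply: cL.
pose F (r : 'I_(size L)) := (boxed (nth (entry0 n) L r).1, sval (cL r)).
have injF : injective F.
  suff noteq (r r' : 'I_(size L)) : r' < r -> F r <> F r'.
    move=> r r' eqF; apply/val_inj/eqP; case: ltngtP => // /noteq; last exact.
    by move=> H; case: (H (esym eqF)).
  move=> lt_r [] /boxedK; rewrite !mem_nth // => /(_ isT isT) eq_q eq_t.
  have /andP[_ /allP/(_ (nth (entry0 n) L r'))] := svalP (cL r).
  rewrite -(nth_take _ lt_r) mem_nth; last by rewrite size_takel // ltnW.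
  move/(_ isT)/negP; apply; rewrite nth_take // /hits -eq_q eqxx /= eq_t.
  by have /andP[] := svalP (cL r').
have := leq_card F injF.
by rewrite card_ord !card_prod !card_ord card_tuple card_bool !expnS expn0 muln1 !mulnA.
Qed.

Fixpoint steps (us : seq 'I_n) (q q' : state) : Prop :=
  if us is u :: us' then exists2 q1, q1 \in succ q u & steps us' q1 q' else q = q'.

(* The entry that represents a prefix of the run may use other vertices than this
   prefix, but none of those that the rest of the run uses. *)
Lemma covered_steps K (L : seq (entry n)) :
  n * 2 ^ K <= 2 ^ k -> good L -> (state0 n, set0) \in L ->
  (forall e, e \in L -> #|e.2| < K -> forall u : 'I_n, u \notin e.2 ->
     forall q, q \in succ e.1 u -> covered k L (q, u |: e.2)) ->
  forall us q, uniq us -> size us <= K -> steps us (state0 n) q ->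
  exists A, (q, A) \in L.
Proof.
move=> leK [rL _] L0 closedL us q.
suff main us1 q1 A1 : (q1, A1) \in L -> uniq us1 -> [disjoint A1 & us1] ->
    #|A1| + size us1 <= K -> steps us1 q1 q -> exists A, (q, A) \in L.
  by move=> uus le_us; apply: main L0 uus _ _; rewrite ?cards0 //; apply/pred0P => w /=; rewrite inE.
elim: us1 q1 A1 => [|u us1 IH] q1 A1 L1 /=; first by move=> _ _ _ <-; exists A1.
move=> /andP[u_us1 uus1] dis1 le1 [q2 q2P st2].
have uA1 : u \notin A1 by rewrite (disjointFl dis1) // inE eqxx.
have dis2 : [disjoint A1 & us1] by apply: disjointWr dis1; apply/subsetP => w; rewrite inE orbC => ->.
have cov2 : covered k L (q2, u |: A1) by apply: (closedL (q1, A1)) => //=; lia.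
pose T := (u |: A1) :|: [set w in us1].
have card_u : #|u |: A1| = #|A1|.+1 by rewrite cardsU1 uA1.
have leT : #|T| <= K.
  rewrite (leq_trans (leq_card_setU _ _).1) // card_u addSnnS.
  by rewrite (leq_trans _ le1) // leq_add2l ltnS cardsE card_size.
have [t tP] := ex_lbit (fun w => w \in u |: A1) leK leT.
have sub_t : u |: A1 \subset lfsr_set n k t.
  by apply/subsetP => w wA; rewrite inE tP // in_setU wA.
have [[q2' A2] L2 /andP[/= /eqP eq_q sA2]] := coveredP (e := (q2, u |: A1)) cov2 sub_t.
subst q2'.
have card2 : #|A2| = #|A1|.+1.
  have := rL _ L2; have := rL _ L1; rewrite /=.
  case: q1 q2 q2P {st2 L1 L2 cov2} => [[[s v] c] j] [[[s' v'] c'] j'] q2P.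
  move=> /reached_bounds[_ _ _ <-] /reached_bounds[_ _ _ <-].
  by move: q2P; rewrite /= mem_cat; case: close; case: step; rewrite /= ?inE ?orbF //;
    do ?[case/orP]; case/eqP.
apply: IH L2 uus1 _ _ st2; last by rewrite card2 addSnnS.
rewrite disjoint_sym disjoint_subset; apply/subsetP => w w_us1; rewrite inE.
apply/negP => /(subsetP sA2); rewrite inE tP; last by rewrite !inE w_us1 orbT.
rewrite !inE => /predU1P[eq_wu|wA1]; first by rewrite -eq_wu w_us1 in u_us1.
by rewrite (disjointFr dis2 wA1) in w_us1.
Qed.

End AbstractSearch.

(** * The search of the program *)

Definition close_of n (m : memory) (s v : nat) : bool :=
  0 < nmem m aPair (s * n + v).

Definition step_of n (m : memory) (s v u : nat) : bool :=
  [&& 0 < nmem m aAdj (v * n + u), 0 < nmem m aReach (s * n + v)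
    & (wmem m 1 (s * n + v) + wmem m 0 (v * n + u) <= wmem m 1 (s * n + u))%R].

Lemma run_branch N n k (G : seq (entry n) -> Prop) (L : seq (entry n)) b es ec m
    s v c j (A : {set 'I_n}) (e := (s, v, c, j, A)) :
  nmem m aHdr 0 = n -> nmem m xM 0 = k -> n <= N -> 2 ^ (k + k) <= N -> size L <= N ->
  stores m L -> neval m es = s -> neval (set_cell m cS s) ec = c ->
  nmem m cV 0 = v -> nmem m cJ 0 = j -> (forall u : 'I_n, nmem m aCand u = (u \in A)) ->
  G L -> (teval m b -> G (add_entry k L e)) ->
  run N (If b (cS <-- es ;; cC <-- ec ;; add_cmd) Skip)%cmd m
    (fun m' => exists L', [/\ stores m' (L ++ L'), G (L ++ L') &
       teval m b -> covered k (L ++ L') e]).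
Proof.
move=> mn mk nN kN LN mL esE ecE eV eJ eA GL GLe; apply: run_if => b_m.
  apply/run_seq/run_nset/run_seq/run_nset => /=; rewrite esE.
  rewrite -/(set_cell m cS s) ecE.
  apply: run_conseq (@run_add N n k L e _ _ _ _ _ _ _ _) _ => // m' _.
  by have [L' addE] := add_entry_sub k L e; exists L'; rewrite -addE covered_add;
    split=> //; apply: GLe.
by apply: run_skip; exists [::]; rewrite cats0; split=> // /(negP b_m).
Qed.

Lemma run_expand N n k m (close := close_of n m) (step := step_of n m)
    (L : seq (entry n)) h (e := nth (entry0 n) L h) :
  nmem m aHdr 0 = n -> nmem m xM 0 = k -> n <= N -> 2 ^ (k + k) <= N ->
  (forall L : seq (entry n), good k close step L -> size L <= N) ->
  (forall i, i <= n -> nmem m aMul i = i * n) -> nmem m xHead 0 = h ->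
  h < size L -> stores m L -> good k close step L ->
  run N expand_cmd m (fun m' => exists L', [/\ stores m' (L ++ L'),
    good k close step (L ++ L') & forall u : 'I_n, u \notin e.2 ->
      forall q, q \in succs close step e.1 u -> covered k (L ++ L') (q, u |: e.2)]).
Proof.
move=> mn mk nN kN GN mM mh lt_h mL gL.
apply: (@run_for _ _ _ _ _ n (fun i m' => exists L', [/\ stores m' (L ++ L'),
    good k close step (L ++ L') & forall u : 'I_n, u < i -> u \notin e.2 ->
      forall q, q \in succs close step e.1 u -> covered k (L ++ L') (q, u |: e.2)])) => //.
- by move=> m' F /=; fr F.
- by exists [::]; rewrite cats0; split.
- move=> i m2 lt_i xi F [L2 [m2L g2 cov2]].
  pose u := Ordinal lt_i.
  have m2n : nmem m2 aHdr 0 = n by fr F.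
  have m2h : nmem m2 xHead 0 = h by fr F.
  have lt_h2 : h < size (L ++ L2) by rewrite size_cat ltn_addr.
  have m2b : nmem m2 rBase h = h * n by have [_ -> //] := m2L; rewrite ltnW.
  have eE : nth (entry0 n) (L ++ L2) h = e by rewrite nth_cat lt_h.
  have eL : e \in L ++ L2 by rewrite -eE mem_nth.
  have [_ _ /(_ h lt_h2)] := m2L; rewrite eE.
  have rE : reached (succs close step) e.1 e.2 by case: g2 => r2 _; apply: r2.
  case: e eE eL rE cov2 => [[[[s v] c] j] A] /= eE eL rE cov2 [eS eV eC eJ eA].
  have [les lev _ _] := reached_bounds rE.
  have skip L3 : {subset L ++ L2 <= L3} -> (u \notin A ->
      forall q, q \in succs close step (s, v, c, j) u -> covered k L3 (q, u |: A)) ->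
      forall w : 'I_n, w < i.+1 -> w \notin A ->
        forall q, q \in succs close step (s, v, c, j) w -> covered k L3 (q, w |: A).
    move=> sub3 cov3 w; rewrite ltnS leq_eqVlt => /predU1P[eq_w|lt_w].
      by have -> : w = u by apply: val_inj.
    by move=> wA q qw; apply: covered_sub sub3 _; apply: cov2.
  apply: run_if => /=; rewrite m2h m2b xi (eA u) leqn0 eqb0 => uA; last first.
    apply: run_skip; exists L2; split=> //; apply: skip => //.
    by rewrite (negPf uA).
  apply/run_seq/(@run_for _ _ _ _ _ n (fun i' m3 =>
    forall w : 'I_n, w < i' -> nmem m3 aCand w = (w \in A))) => //.
  + by move=> m3 F3 /=; fr F3.
  + move=> i' m3 lt_i' xi' F3 I3; apply: run_nset => /= w.
    have m3h : nmem m3 xHead 0 = h by fr F3.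
    have m3b : nmem m3 rBase h = h * n by fr F3.
    have m3i : nmem m3 rBits (h * n + i') = (Ordinal lt_i' \in A).
      by fr F3; rewrite (eA (Ordinal lt_i')).
    rewrite ltnS leq_eqVlt m3h m3b xi' m3i => /predU1P[eq_w|lt_w].
      by rewrite eq_w eqxx (_ : Ordinal lt_i' = w) //; apply: val_inj.
    by rewrite ltn_eqF // I3.
  move=> m3 F3 I3.
  have m3h : nmem m3 xHead 0 = h by fr F3.
  have m3i : nmem m3 47 0 = i by fr F3.
  have m3j : nmem m3 rJ h = j by fr F3.
  apply/run_seq/run_nset/run_seq/run_nset/run_seq/run_nset => /=.
  rewrite m3i m3h m3j addn1.
  set m4 := Memory _ _.
  have m4A : forall w : 'I_n, nmem m4 aCand w = (w \in u |: A).
    move=> w; rewrite /m4 /= in_setU1 -val_eqE /=.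
    by case: eqP => // _; apply: I3.
  have m4L : stores m4 (L ++ L2).
    by apply: stores_same m2L; split; [..|split]; rewrite /m4 /=; fr F3.
  have m4close : teval m4 closed_test = close s v.
    rewrite /= m3h; fr F3; rewrite eS eV; fr F.
    by rewrite mM.
  apply: run_seq; apply: run_conseq (@run_branch N n k (good k close step) (L ++ L2)
     closed_test (cell 47) _ m4 i i c.+1 j.+1 (u |: A) _ _ _ _ _ _ _ _ _ _ _ _ _) _ => //.
  + by move=> /=; fr F3; fr F.
  + by move=> /=; fr F3; fr F.
  + exact: GN.
  + by rewrite /= m3h; fr F3; rewrite eC addn1.
  + rewrite m4close => cl.
    apply: (@good_add n k close step (L ++ L2) _ u) eL uA _ => //=.
    by rewrite cl /= inE eqxx.
  move=> m5 F5 [L5 [m5L g5]]; rewrite m4close => cov5.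
  have eL5 : (s, v, c, j, A) \in (L ++ L2) ++ L5 by rewrite mem_cat eL.
  have lt_h5 : h < size ((L ++ L2) ++ L5) by rewrite size_cat ltn_addr.
  have [_ _ /(_ h lt_h5)] := m5L; rewrite nth_cat lt_h2 eE => -[eS5 eV5 eC5 _ _].
  have m5step : teval m5 step_test = step s v u.
    rewrite /=; fr F5; rewrite m3h m3i eS5 eV5; fr F3; fr F.
    by rewrite !mM // -andbA.
  apply: run_conseq (@run_branch N n k (good k close step) ((L ++ L2) ++ L5)
     step_test source_expr _ m5 s i c j.+1 (u |: A) _ _ _ _ _ _ _ _ _ _ _ _ _) _ => //.
  + by fr F5; fr F3; fr F.
  + by fr F5; fr F3; fr F.
  + exact: GN.
  + by rewrite /=; fr F5; rewrite m3h.
  + by rewrite /=; fr F5; rewrite m3h.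
  + by fr F5.
  + by fr F5.
  + by move=> w; fr F5; apply: m4A.
  + rewrite m5step => st.
    apply: (@good_add n k close step _ _ u) eL5 uA _ => //=.
    by rewrite mem_cat st inE eqxx orbT.
  move=> m6 F6 [L6 [m6L g6]]; rewrite m5step => cov6.
  exists (L2 ++ L5 ++ L6); rewrite !catA; split=> //; apply: skip.
    by move=> f; rewrite !mem_cat -!orbA orbCA orbA => /orP[]->; rewrite ?orbT.
  move=> _ q; rewrite /= mem_cat => /orP[].
    case: ifP => // cl; rewrite inE => /eqP ->.
    by apply: covered_sub (cov5 cl) => f; rewrite [in X in _ -> X]mem_cat => ->.
  by case: ifP => // st; rewrite inE => /eqP ->; apply: cov6.
- by move=> m2 F [L2 [m2L g2 cov2]]; exists L2; split=> // u; apply: cov2.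
Qed.

Definition accepting (close : nat -> nat -> bool) (p : nat) (q : state) : bool :=
  let: (s, v, c, _) := q in close s v && (p <= c).

Lemma run_search N n lg K p m (close := close_of n m) (step := step_of n m)
    (k := lg + K) :
  nmem m aHdr 0 = n -> nmem m xLog 0 = lg -> nmem m xK 0 = K -> nmem m xThr 0 = p ->
  nmem m xAns 0 = 0 -> n <= N -> 2 ^ (k + k) <= N ->
  (forall L : seq (entry n), good k close step L -> size L <= N) ->
  (forall i, i <= n -> nmem m aMul i = i * n) ->
  run N search_cmd m (fun m' => exists L : seq (entry n),
    [/\ good k close step L, (state0 n, set0) \in L,
        forall e, e \in L -> #|e.2| < K -> forall u : 'I_n, u \notin e.2 ->
          forall q, q \in succs close step e.1 u -> covered k L (q, u |: e.2)
      & nmem m' xAns 0 = has (fun e => accepting close p e.1) L]).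
Proof.
move=> mn mlg mK mp mans nN kN GN mM.
do 5![apply/run_seq/run_nset => /=].
rewrite mn mlg mK -/k; set m1 := Memory _ _.
apply/run_seq/(@run_for _ _ _ _ _ n
  (fun i m2 => forall u : 'I_n, u < i -> nmem m2 rBits u = 0)) => //.
- by move=> m2 F; rewrite /=; fr F.
- move=> i m2 lt_i xi F I2; apply: run_nset => /= u; rewrite xi ltnS leq_eqVlt.
  by case: eqP => //= _; apply: I2.
move=> m2 F2 I2; do 4![apply/run_seq/run_nset => /=].
have m2n : nmem m2 0 0 = n by fr F2.
rewrite m2n; set m3 := Memory _ _.
pose good' (L : seq (entry n)) := good k close step L.
pose closed_at L (e : entry n) := #|e.2| < K -> forall u : 'I_n, u \notin e.2 ->
          forall q, q \in succs close step e.1 u -> covered k L (q, u |: e.2).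
apply: (@run_while _ _ _ _ (fun h m4 => exists L : seq (entry n),
  [/\ stores m4 L, good' L & (state0 n, set0) \in L] /\
  [/\ nmem m4 xHead 0 = h, h <= size L,
    forall r, r < h -> closed_at L (nth (entry0 n) L r) &
    nmem m4 xAns 0 = has (fun e => accepting close p e.1) (take h L)])).
- exists [:: (state0 n, set0)]; split; split; rewrite ?inE ?eqxx //.
  + split=> [//|[|[|r]]|[|//]] //=; rewrite ?mul1n // => _.
    by split=> [||||u] /=; fr F2; rewrite ?in_set0 ?mul0n ?add0n ?I2.
  + exact: good_single.
  + by rewrite /=; fr F2.
- move=> h m4 F4 [L [[m4L gL L0] [m4h leh closedL ans]]] /=.
  have [m4c _ _] := m4L; rewrite m4h m4c addn1 => lt_h.
  split; first exact: leq_trans lt_h (GN _ gL).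
  have m4n : nmem m4 0 0 = n by fr F4.
  have m4k : nmem m4 xM 0 = k by fr F4; fr F2.
  have m4K : nmem m4 xK 0 = K by fr F4; fr F2.
  have m4p : nmem m4 xThr 0 = p by fr F4; fr F2.
  have m4M i : i <= n -> nmem m4 aMul i = i * n by move=> le_i; fr F4; fr F2; apply: mM.
  have m4close : close_of n m4 = close.
    by rewrite /close /close_of; fr F4; fr F2.
  have m4step : step_of n m4 = step.
    by rewrite /step /step_of; fr F4; fr F2.
  set e := nth (entry0 n) L h; have eL : e \in L by rewrite mem_nth.
  have [_ _ /(_ h lt_h)] := m4L; rewrite -/e.
  have rE : reached (succs close step) e.1 e.2 by case: gL => r2 _; apply: r2.
  have acc : teval m4 (TAnd closed_test (NLe $xThr (rC@($xHead)))) =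
      accepting close p e.1.
    have [_ _ /(_ h lt_h)] := m4L; rewrite -/e.
    case: e rE {eL} => [[[[s v] c] j] A] /reached_bounds[les lev _ _] [eS eV eC _ _].
    by rewrite /= m4h m4p eS eV eC m4M // -m4close.
  move=> stored_e; apply: run_seq.
  apply: (@run_conseq _ _ _ (fun m5 => nmem m5 xAns 0 =
      has (fun e => accepting close p e.1) (take h.+1 L))).
    rewrite (take_nth (entry0 n)) // has_rcons -/e.
    apply: run_if; rewrite acc => ae; [apply: run_nset | apply: run_skip] => /=.
      by rewrite ae.
    by rewrite ans (negPf ae).
  move=> m5 F5 ans5; apply: run_seq.
  apply: (@run_conseq _ _ _ (fun m6 => exists L', [/\ stores m6 (L ++ L'),
     good' (L ++ L') & closed_at (L ++ L') e])).
    have m5L : stores m5 L by apply: stores_same m4L; split; [..|split]; fr F5.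
    have m5j : teval m5 (NLt (rJ@($xHead)) $xK) = (#|e.2| < K).
      have [_ _ /(_ h lt_h)] := m5L; rewrite -/e.
      case: e rE {eL acc stored_e} => [[[[s v] c] j] A] /reached_bounds[/= _ _ _ jE] [_ _ _ eJ _].
      have m5h : nmem m5 xHead 0 = h by fr F5.
      have m5K : nmem m5 xK 0 = K by fr F5.
      by rewrite /= m5h m5K eJ addn1 jE.
    apply: run_if; rewrite m5j => jK; last first.
      by apply: run_skip; exists [::]; rewrite cats0; split=> // /(negP jK).
    have m5close : close_of n m5 = close by rewrite -m4close /close_of; fr F5.
    have m5step : step_of n m5 = step by rewrite -m4step /step_of; fr F5.
    apply: run_conseq (@run_expand N n k m5 L h _ _ _ _ _ _ _ _ _ _) _ => //.
    + by fr F5.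
    + by fr F5.
    + by rewrite m5close m5step.
    + by fr F5.
    + by fr F5.
    + by rewrite m5close m5step.
    + by rewrite m5close m5step => m6 _ [L' [m6L g6 cov6]]; exists L'; split=> // _.
  move=> m6 F6 [L' [m6L g6 cov6]]; apply: run_nset => /=.
  exists (L ++ L'); split; split=> //; rewrite ?mem_cat ?L0 //=.
  + by fr F6; fr F5; rewrite m4h addn1.
  + by rewrite size_cat ltn_addr.
  + move=> r; rewrite ltnS leq_eqVlt => /predU1P[->|lt_r].
      by rewrite nth_cat lt_h.
    rewrite nth_cat (ltn_trans lt_r lt_h) => cA u uA q qu.
    apply: covered_sub (closedL _ lt_r cA u uA q qu) => f.
    by rewrite mem_cat => ->.
  + by fr F6; rewrite ans5 takel_cat.
- move=> h m4 F4 [L [[m4L gL L0] [m4h leh closedL ans]]] /=.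
  have [m4c _ _] := m4L; rewrite m4h m4c addn1 -leqNgt => geh.
  exists L; split=> //.
    move=> e /(nthP (entry0 n))[r lt_r <-]; apply: closedL.
    exact: leq_trans geh.
  by rewrite ans take_oversize.
Qed.

(** * Distances *)

Lemma row_major_at (T : Type) (x0 : T) n (f : 'I_n -> 'I_n -> T) (u v : 'I_n) :
  row_major x0 f (u * n + v) = f u v.
Proof.
have n_gt0 : 0 < n by apply: leq_ltn_trans (ltn_ord u).
rewrite /row_major divnMDl // divn_small // addn0 modnMDl modn_small //.
by rewrite !valK.
Qed.

(* [R] relates a memory to a later one. *)
Lemma run_for_mono N n x c m (J : memory -> Prop) (R : memory -> memory -> Prop)
    (Phi : 'I_n -> memory -> Prop) :
  x \notin nwrites c -> aHdr \notin nwrites (For x eN c) ->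
  nmem m aHdr 0 = n -> n <= N ->
  (forall m1 m2 v, R m1 m2 -> R m1 (set_cell m2 x v)) ->
  (forall m', R m' m') -> (forall m1 m2 m3, R m1 m2 -> R m2 m3 -> R m1 m3) ->
  (forall m1 m2, R m1 m2 -> forall i, Phi i m1 -> Phi i m2) ->
  (forall m' v, J m' -> J (set_cell m' x v)) -> J m ->
  (forall (i : 'I_n) m', nmem m' x 0 = i -> frame (For x eN c) m m' -> J m' ->
     run N c m' (fun m'' => [/\ J m'', R m' m'' & Phi i m''])) ->
  run N (For x eN c) m (fun m' => [/\ J m', R m m' & forall i, Phi i m']).
Proof.
move=> xc hdr mn nN Rset Rrefl Rtrans PhiR Jset Jm body.
apply: (@run_for_ord _ n _ _ _ _ (fun m' => J m' /\ R m m') Phi) => //.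
- by move=> m' F; rewrite /= (F.1 _ hdr).
- by split; [apply: Jset | apply: Rset].
- move=> i m' xi F [Jm' Rm']; apply: run_conseq (body i m' xi F Jm') _ => m'' _ [J2 R2 P2].
  have R3 : R m'' (set_cell m'' x i.+1) by apply: Rset.
  split.
  + by split; [apply: Jset | apply: Rset; apply: Rtrans R2].
  + exact: PhiR R3 _ P2.
  + by move=> i' _; apply: PhiR; apply: Rset.
- by move=> m' F [Jm' Rm'] Pm'.
Qed.

Section Distances.

Variable I : instance.
Let n := nv I.
Implicit Types (m : memory) (s u v : 'I_n) (p : seq 'I_n).

Definition known m s v (x : rat) : Prop :=
  0 < nmem m aReach (s * n + v) /\ (wmem m 1 (s * n + v) <= x)%R.

Definition keeps_known m m' : Prop := forall s v x, known m s v x -> known m' s v x.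

Definition sound m : Prop := forall s v, 0 < nmem m aReach (s * n + v) ->
  exists p, [/\ path (@edge I) s p, last s p = v & path_length s p = wmem m 1 (s * n + v)].

Definition has_graph m : Prop :=
  (forall u v, nmem m aAdj (u * n + v) = edge u v) /\
  (forall u v, edge u v -> wmem m 0 (u * n + v) = wt u v).

Lemma cell_index_inj s v s' v' : s * n + v = s' * n + v' -> s = s' /\ v = v'.
Proof.
have n_gt0 : 0 < n by apply: leq_ltn_trans (ltn_ord s).
move=> eq_i; have := congr1 (divn^~ n) eq_i; have := congr1 (modn^~ n) eq_i.
rewrite !modnMDl !modn_small // !divnMDl // !divn_small // !addn0.
by move=> eq_v eq_s; split; apply: val_inj.
Qed.

Lemma path_length_rcons s p v :
  path_length s (rcons p v) = (path_length s p + wt (last s p) v)%R.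
Proof.
by elim: p s => [|u p IHp] s /=; rewrite ?addr0 ?add0r // IHp addrA.
Qed.

Lemma run_relax N m s u v :
  has_graph m -> (forall i, i <= n -> nmem m aMul i = i * n) ->
  nmem m 53 0 = s -> nmem m 54 0 = u -> nmem m 55 0 = v -> sound m ->
  run N relax_cmd m (fun m' => [/\ sound m', keeps_known m m' &
    edge u v -> forall x, known m s u x -> known m' s v (x + wt u v)%R]).
Proof.
move=> [mE mW] mM ms mu mv snd.
have leo (w : 'I_n) : w <= n by apply/ltnW/ltn_ord.
apply: run_if => /=; rewrite ms mu mv !mM // mE lt0b.
  case/andP=> /andP[uv su] sv.
  apply/run_seq/run_nset/run_wset => /=; rewrite ms mu mv !mM // mW //.
  set d := (_ + _)%R.
  have sv_le x : known m s v x -> (d <= x)%R.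
    case=> sv1 le_x; move: sv; rewrite sv1 /= mW // -ltNge => /ltW lt_d.
    exact: le_trans lt_d le_x.
  split.
  - move=> a b /=; case: eqP => [/cell_index_inj[-> ->] _ | _]; last exact: snd.
    have [p [sp pu lenp]] := snd _ _ su; exists (rcons p v).
    by rewrite rcons_path sp last_rcons pu path_length_rcons pu lenp.
  - move=> a b x; case: (altP (s * n + v =P a * n + b)) => [/cell_index_inj[<- <-]|ne].
      by move=> /sv_le le_x; rewrite /known /= eqxx.
    by rewrite /known /= eq_sym (negPf ne).
  - move=> _ x [_ le_x]; rewrite /known /= eqxx; split=> //.
    by rewrite lerD2r.
move=> H; apply: run_skip; split=> // uv x [su le_x].
move: H; rewrite uv su /= negbK => /andP[sv le_v]; split=> //.
by rewrite (le_trans le_v) // mW // lerD2r.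
Qed.

Lemma run_round N m :
  nmem m aHdr 0 = n -> n <= N -> has_graph m ->
  (forall i, i <= n -> nmem m aMul i = i * n) -> sound m ->
  run N (For 53 eN (For 54 eN (For 55 eN relax_cmd))) m
    (fun m' => [/\ sound m', keeps_known m m' & forall s u v, edge u v ->
       forall x, known m s u x -> known m' s v (x + wt u v)%R]).
Proof.
move=> mn nN mG mM snd.
pose Phi s u v m' := edge u v -> forall x, known m s u x -> known m' s v (x + wt u v)%R.
pose J m' := sound m' /\ keeps_known m m'.
have kk_refl m1 : keeps_known m1 m1 by [].
have kk_trans m1 m2 m3 : keeps_known m1 m2 -> keeps_known m2 m3 -> keeps_known m1 m3.
  by move=> k12 k23 s v x /k12/k23.
apply: (run_conseq (Q := fun m' =>
    [/\ J m', keeps_known m m' & forall s, (forall u v, Phi s u v m')])); last first.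
  by move=> m' _ [[snd' _] kk' P']; split=> // s u v; apply: P'.
apply: run_for_mono => //.
  by move=> m1 m2 k12 s P1 u v uv x kx; apply: k12; apply: P1.
move=> s m1 xs F1 J1; apply: run_for_mono => //.
- by fr F1.
- by move=> m2 m3 k23 u P2 v uv x kx; apply: k23; apply: P2.
move=> u m2 xu F2 J2; apply: run_for_mono => //.
- by fr F2; fr F1.
- by move=> m3 m4 k34 v P3 uv x kx; apply: k34; apply: P3.
move=> v m3 xv F3 [snd3 k3].
have m3s : nmem m3 53 0 = s by fr F3; fr F2.
have m3u : nmem m3 54 0 = u by fr F3.
have m3G : has_graph m3 by rewrite /has_graph; fr F3; fr F2; fr F1.
have m3M i : i <= n -> nmem m3 aMul i = i * n.
  by move=> le_i; fr F3; fr F2; fr F1; apply: mM.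
apply: run_conseq (run_relax _ m3G m3M m3s m3u xv snd3) _ => m4 _ [snd4 k4 P4].
split=> //; first by split=> // a b x /k3/k4.
by move=> uv x /k3; apply: P4.
Qed.

Lemma run_distances N m :
  nmem m aHdr 0 = n -> n <= N -> has_graph m ->
  (forall i, i <= n -> nmem m aMul i = i * n) ->
  (forall i, nmem m aReach i = 0) -> (forall i, wmem m 1 i = 0%R) ->
  run N distances_cmd m (fun m' => sound m' /\
    forall s p, path (@edge I) s p -> size p <= n ->
      known m' s (last s p) (path_length s p)).
Proof.
move=> mn nN mG mM mR mD.
apply/run_seq/(@run_for_ord _ n _ _ _ _ sound (fun s m' => known m' s s 0)) => //.
- by move=> m' F; rewrite /=; fr F.
- by move=> s v; rewrite /= mR.
- move=> s m1 xs F snd; apply: run_nset => /=.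
  have m1M : nmem m1 aMul s = s * n by fr F; rewrite mM // ltnW.
  rewrite xs m1M; have m1D i : wmem m1 1 i = 0%R by fr F.
  split.
  + move=> a b; rewrite /=; case: eqP => [/cell_index_inj[-> ->] _|_]; last exact: snd.
    by exists [::]; rewrite m1D.
  + by rewrite /known /= eqxx m1D.
  + by move=> s' _ [k1 k2]; split=> //=; case: ifP.
move=> m1 F1 snd1 k1.
have m1n : nmem m1 aHdr 0 = n by fr F1.
have m1G : has_graph m1 by rewrite /has_graph; fr F1.
have m1M i : i <= n -> nmem m1 aMul i = i * n by fr F1; apply: mM.
apply: (@run_for _ _ _ _ _ n (fun r m' => sound m' /\
    forall s p, path (@edge I) s p -> size p <= r ->
      known m' s (last s p) (path_length s p))) => //.
- by move=> m2 F2; rewrite /=; fr F2.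
- by split=> // s [|? ?] // _ _; apply: k1.
- move=> r m2 lt_r xr F2 [snd2 k2].
  have m2n : nmem m2 aHdr 0 = n by fr F2.
  have m2G : has_graph m2 by rewrite /has_graph; fr F2.
  have m2M i : i <= n -> nmem m2 aMul i = i * n by fr F2; apply: m1M.
  apply: run_conseq (run_round m2n nN m2G m2M snd2) _ => m3 _ [snd3 k3 step3].
  split=> // s p; elim/last_ind: p => [|p v _].
    by move=> sp _; apply: (k3 s s 0%R); apply: (k2 s [::]).
  rewrite rcons_path size_rcons last_rcons path_length_rcons => /andP[sp pv] lt_p.
  by apply: step3 pv _ _; apply: k2.
Qed.

End Distances.

(** * Solutions and runs of the search *)

Section Paths.

Variable I : instance.
Let n := nv I.
Implicit Types (s t u v : 'I_n) (p q : seq 'I_n).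

Lemma path_length_cat s p q :
  path_length s (p ++ q) = (path_length s p + path_length (last s p) q)%R.
Proof. by elim: p s => [|v p IHp] s /=; rewrite ?add0r // IHp addrA. Qed.

Lemma path_length_ge0 s p : path (@edge I) s p -> (0 <= path_length s p)%R.
Proof.
by elim: p s => //= v p IHp s /andP[sv vp]; rewrite addr_ge0 ?IHp ?wt_ge0.
Qed.

Lemma shorten_walk s p : path (@edge I) s p ->
  exists2 q, is_path s (last s p) q & (path_length s q <= path_length s p)%R.
Proof.
elim: p s => [|u p IHp] s /=; first by exists [::].
case/andP=> su up; have [q [uq uniq_q last_q] le_q] := IHp _ up.
have {IHp}le_uq : (path_length s (u :: q) <= wt s u + path_length u p)%R.
  by rewrite lerD2l.
have [s_q | s'q] := boolP (s \in u :: q); last first.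
  by exists (u :: q) => //; split; rewrite ?(cons_uniq s) ?s'q //= su.
have sq : path (@edge I) s (u :: q) by rewrite /= su uq.
move: le_uq sq uniq_q last_q; rewrite -[last u q]/(last s (u :: q)).
case/splitPr: s_q => q1 q2 le_q12 + uniq_q12.
rewrite cat_path /= last_cat /= => /and3P[sq1 q1s sq2] last_q.
exists q2; first by split=> //; move: uniq_q12; rewrite cat_uniq => /and3P[].
apply: le_trans le_q12; rewrite path_length_cat /= addrA lerDr.
by rewrite addr_ge0 ?path_length_ge0 ?wt_ge0.
Qed.

Lemma size_is_path s t p : is_path s t p -> size p < n.
Proof.
by case=> _ /card_uniqP/= <- _; rewrite -[X in _ <= X]card_ord max_card.
Qed.

Variables (r : 'I_n -> 'I_n -> bool) (D : 'I_n -> 'I_n -> rat).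
Hypothesis D_walk : forall s v, r s v ->
  exists p, [/\ path (@edge I) s p, last s p = v & path_length s p = D s v].
Hypothesis D_le : forall s p, path (@edge I) s p -> size p <= n ->
  r s (last s p) /\ (D s (last s p) <= path_length s p)%R.

Variables (close : nat -> nat -> bool) (step : nat -> nat -> nat -> bool).
Hypothesis closeE : forall s v, close s v = [exists i, (src i == s) && (snk i == v)].
Hypothesis close_n : close n n.
Hypothesis stepE : forall s v u,
  step s v u = [&& edge v u, r s v & (D s v + wt v u <= D s u)%R].
Hypothesis step_n : forall u, step n n u = false.

Fixpoint tight s v p : bool :=
  if p is u :: p' then step s v u && tight s u p' else true.

Lemma tight_path s v p : tight s v p -> path (@edge I) v p.
Proof.
by elim: p v => //= u p IHp v /andP[]; rewrite stepE => /and3P[-> _ _] /IHp.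
Qed.

Lemma tight_length s v p : tight s v p ->
  (D s v + path_length v p <= D s (last v p))%R.
Proof.
elim: p v => [|u p IHp] v /=; first by rewrite addr0.
case/andP; rewrite stepE => /and3P[_ _ le_u] /IHp le_p.
by rewrite addrA (le_trans _ le_p) // lerD2r.
Qed.

Lemma tight_rcons s v p u :
  tight s v (rcons p u) = tight s v p && step s (last v p) u.
Proof. by elim: p v => [|w p IHp] v /=; rewrite ?andbT // IHp andbA. Qed.

Lemma D_diag s : (0 <= D s s)%R.
Proof.
have [//|rs _] := @D_le s [::] isT; have [p [sp _ <-]] := D_walk rs.
exact: path_length_ge0.
Qed.

Lemma tight_shortest s t p :
  tight s s p -> uniq (s :: p) -> last s p = t -> is_shortest_path s t p.
Proof.
move=> tp up lp; split; first by split=> //; apply: tight_path tp.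
move=> q qP; have [sq _ lq] := qP; have [_] := D_le sq (ltnW (size_is_path qP)).
rewrite lq -lp; apply: le_trans; apply: le_trans (tight_length tp).
by rewrite lerDr D_diag.
Qed.

Lemma shortest_tight s t p : is_shortest_path s t p -> tight s s p.
Proof.
move=> [pP pmin]; have [sp _ lp] := pP; have ltp := size_is_path pP.
suff main p1 p2 : p = p1 ++ p2 -> tight s (last s p1) p2 by apply: (main [::]).
elim: p2 p1 => //= u p2 IHp p1 pE.
have pE' : p = rcons p1 u ++ p2 by rewrite cat_rcons.
have := IHp _ pE'; rewrite last_rcons => ->; rewrite andbT stepE.
move: (sp); rewrite pE cat_path /= => /and3P[sp1 vu up2].
have le1 : size p1 <= n by rewrite (leq_trans _ (ltnW ltp)) // pE size_cat leq_addr.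
have le1' : size (rcons p1 u) <= n.
  by rewrite (leq_trans _ (ltnW ltp)) // pE' size_cat leq_addr.
have [rv le_v] := D_le sp1 le1.
have su : path (@edge I) s (rcons p1 u) by rewrite rcons_path sp1.
have [] := D_le su le1'; rewrite last_rcons => ru _.
rewrite vu rv /=; have [q [sq lq <-]] := D_walk ru.
have sqp2 : path (@edge I) s (q ++ p2) by rewrite cat_path sq lq.
have [q' q'P le_q'] := shorten_walk sqp2.
have q'P' : is_path s t q' by move: q'P; rewrite -lp pE' !last_cat last_rcons lq.
have := le_trans (pmin q' q'P') le_q'.
rewrite pE' !path_length_cat lq last_rcons lerD2r path_length_rcons.
by apply: le_trans; rewrite lerD2r.
Qed.

Definition valid (S : {set 'I_(npairs I)}) (P : 'I_(npairs I) -> seq 'I_n) : Prop :=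
  (forall i, i \in S -> is_shortest_path (src i) (snk i) (P i)) /\
  (forall i j, i \in S -> j \in S -> i != j -> [disjoint src i :: P i & src j :: P j]).

Lemma valid_add S P i p (P' := fun k => if k == i then p else P k) :
  valid S P -> is_shortest_path (src i) (snk i) p ->
  (forall k, k \in S -> [disjoint src k :: P k & src i :: p]) ->
  i \notin S /\ valid (i |: S) P'.
Proof.
move=> [short dis] ip disp; have iS : i \notin S.
  by apply/negP => iS; have /pred0P/(_ (src i)) := disp _ iS; rewrite /= !inE eqxx.
have P'i : P' i = p by rewrite /P' eqxx.
have P'S k : k \in S -> P' k = P k.
  by move=> kS; rewrite /P'; case: eqP => // eq_k; rewrite -eq_k kS in iS.
split=> //; split=> [k|k l].
  by rewrite in_setU1 => /predU1P[->|kS]; rewrite ?P'i ?P'S //; apply: short.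
rewrite !in_setU1 => /predU1P[->|kS] /predU1P[->|lS]; rewrite ?eqxx // ?P'i ?P'S //.
- by rewrite disjoint_sym disp.
- by rewrite disp.
- exact: dis.
Qed.

(* The paths of [S] are complete; [s :: p] is the path under construction. *)
Lemma reached_partial (s0 v0 c j : nat) (A : {set 'I_n}) :
  reached (succs close step) (s0, v0, c, j) A ->
  [/\ s0 = n, v0 = n & c = 0] \/
  exists (s v : 'I_n) p (S : {set 'I_(npairs I)}) P, [/\ [/\ s0 = s, v0 = v, c = #|S|.+1 & valid S P],
    [/\ tight s s p, uniq (s :: p), last s p = v & {subset s :: p <= A}]
    & forall i, i \in S -> {subset src i :: P i <= A} /\
        [disjoint src i :: P i & s :: p]].
Proof.
move eq_q : (s0, v0, c, j) => q rA.
elim: rA s0 v0 c j eq_q => {q A} [|[[[s1 v1] c1] j1] A u q' rA IH uA q'P] s0 v0 c j eq_q.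
  by left; case: eq_q => -> -> -> _.
right; have [[s1n v1n c1n] | [s [v [p [S [P [[s1s v1v c1S vSP] [tp up lp pA] SA]]]]]]] :=
    IH _ _ _ _ erefl.
  move: q'P; rewrite -eq_q s1n v1n c1n /= close_n step_n inE => /eqP[-> -> -> _].
  exists u, u, [::], set0, (fun=> [::]); split=> //.
  - by rewrite cards0; split=> //; split=> i; rewrite inE.
  - by split=> // w; rewrite !inE => ->.
  - by move=> i; rewrite inE.
have uA' (X : seq 'I_n) : {subset X <= A} -> u \notin X by move=> XA; apply: contra uA => /XA.
move: q'P; rewrite -eq_q s1s v1v c1S /= mem_cat => /orP[].
  case: ifP => // cl; rewrite inE => /eqP[-> -> -> _].
  move: cl; rewrite closeE => /existsP[i /andP[/eqP si /eqP ti]].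
  have [iS vS] : i \notin S /\ valid (i |: S) (fun k => if k == i then p else P k).
    apply: valid_add => // [|k /SA[_]]; rewrite si ?ti //.
    exact: tight_shortest.
  exists u, u, [::], (i |: S), (fun k => if k == i then p else P k); split=> //.
  - by rewrite cardsU1 iS.
  - by split=> // w; rewrite !inE => ->.
  move=> k kS'; have kA : {subset src k :: (if k == i then p else P k) <= A}.
    case: eqP kS' => [->|ne]; first by rewrite si.
    by rewrite in_setU1 => /predU1P[/ne|/SA[]].
  split; first by move=> w /kA wA; rewrite !inE wA orbT.
  by rewrite disjoint_sym disjoint_cons uA' // disjoint_has.
case: ifP => // st; rewrite inE => /eqP[-> -> -> _].
exists s, u, (rcons p u), S, P; rewrite -!rcons_cons; split=> [||i /SA[iA id]].
- by [].
- have unq : uniq (s :: rcons p u) by rewrite -rcons_cons rcons_uniq uA'.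
  rewrite tight_rcons tp lp st last_rcons; split=> // w.
  by rewrite mem_rcons in_cons in_setU1 => /predU1P[->|/pA->]; rewrite ?eqxx ?orbT.
- split; first by move=> w /iA wA; rewrite !inE wA orbT.
  rewrite disjoint_sym -cats1 disjoint_cat disjoint_sym id.
  by rewrite disjoint_cons uA' // disjoint_has.
Qed.

Lemma reached_valid (s v c j : nat) (A : {set 'I_n}) :
  reached (succs close step) (s, v, c, j) A -> close s v ->
  exists (S : {set 'I_(npairs I)}) P, valid S P /\ #|S| = c.
Proof.
move=> rA cl; have [[s1n v1n ->] | [s1 [v1 [p [S [P [[s1s v1v cS vSP] [tp up lp pA] SA]]]]]]] :=
    reached_partial rA.
  exists set0, (fun=> [::]); split; last exact: cards0.
  by split=> i; rewrite inE.
move: cl; rewrite s1s v1v closeE => /existsP[i /andP[/eqP si /eqP ti]].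
have [iS vS] : i \notin S /\ valid (i |: S) (fun k => if k == i then p else P k).
  apply: valid_add => // [|k /SA[_]]; rewrite si ?ti //.
  exact: tight_shortest.
by exists (i |: S), (fun k => if k == i then p else P k); rewrite cardsU1 iS cS.
Qed.

Lemma steps_cat p q (q1 q2 q3 : state) :
  steps close step p q1 q2 -> steps close step q q2 q3 ->
  steps close step (p ++ q) q1 q3.
Proof.
elim: p q1 => [|u p IHp] q1 /=; first by move=> ->.
by case=> q' q'1 p12 q23; exists q' => //; apply: IHp.
Qed.

Lemma tight_steps s v p (c j : nat) : tight s v p ->
  steps close step p (s : nat, v : nat, c, j) (s : nat, last v p : nat, c, j + size p).
Proof.
elim: p v j => [|u p IHp] v j /=; first by rewrite addn0.
case/andP=> st /IHp tp; rewrite -addSnnS; eexists; last exact: tp.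
by rewrite mem_cat st inE eqxx orbT.
Qed.

Definition trace (P : 'I_(npairs I) -> seq 'I_n) (l : seq 'I_(npairs I)) : seq 'I_n :=
  flatten [seq src i :: P i | i <- l].

Lemma valid_steps P l (s v c j : nat) :
  (forall i, i \in l -> is_shortest_path (src i) (snk i) (P i)) -> close s v ->
  exists s' v' j' : nat, steps close step (trace P l) (s, v, c, j) (s', v', c + size l, j') /\
    close s' v'.
Proof.
elim: l s v c j => [|i l IHl] s v c j short cl /=.
  by exists s, v, j; rewrite addn0.
have ip : is_shortest_path (src i) (snk i) (P i) by apply: short; rewrite inE eqxx.
have tp := shortest_tight ip; have [[_ _ lp] _] := ip.
have cl' : close (src i) (last (src i) (P i)).
  by rewrite closeE; apply/existsP; exists i; rewrite lp !eqxx.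
have [k kl|s' [v' [j' [st' cl'']]]] := IHl _ _ c.+1 (j.+1 + size (P i)) _ cl'.
  by apply: short; rewrite inE kl orbT.
exists s', v', j'; split=> //; rewrite -addSnnS /trace /=.
exists (src i : nat, src i : nat, c.+1, j.+1); first by rewrite mem_cat cl inE eqxx.
exact: steps_cat (tight_steps _ _ tp) st'.
Qed.

Lemma uniq_trace P l S : valid S P -> {subset l <= S} -> uniq l -> uniq (trace P l).
Proof.
move=> [short dis]; elim: l => // i l IHl lS; rewrite cons_uniq => /andP[i'l ul].
have iS : i \in S by apply: lS; rewrite inE eqxx.
have lS' : {subset l <= S} by move=> k kl; apply: lS; rewrite inE kl orbT.
rewrite -[trace P _]/((src i :: P i) ++ trace P l) cat_uniq IHl // andbT.
have [[_ -> _] _] := short _ iS; apply/hasPn => w /flatten_mapP[k kl wk].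
have ne_ik : i != k by apply: contraNneq i'l => ->.
apply/negP => wi; have /pred0P/(_ w) := dis _ _ iS (lS' _ kl) ne_ik.
by rewrite /= wi wk.
Qed.

Lemma size_trace P l : size (trace P l) = \sum_(i <- l) (size (P i)).+1.
Proof. by rewrite size_flatten /shape -map_comp sumnE big_map. Qed.

End Paths.

(** * Correctness and running time *)

Section Algorithm.

Variable I : instance.
Let n := nv I.
Let k := npairs I.

Definition threshold : nat := if (thr I < 0)%R then 0 else `|thr I|%N.

Lemma thresholdE c : (thr I <= c%:Z)%R = (threshold <= c).
Proof. by rewrite /threshold; case: (ltrP (thr I) 0) => H; lia. Qed.

Lemma run_prelude N : n <= N ->
  run N prelude_cmd (encode I) (fun m =>
    [/\ nmem m xThr 0 = threshold, forall i, i <= n -> nmem m aMul i = i * n,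
        n <= 2 ^ nmem m xLog 0 <= n.*2.+1
      & forall i, nmem m aPair i = (i == n * n + n)]).
Proof.
move=> nN; apply: run_seq.
apply: (@run_conseq _ _ _ (fun m => nmem m xThr 0 = threshold)).
  apply: run_if => /=; rewrite lt0b /threshold => H.
    by apply: run_skip; rewrite H.
  by apply: run_nset; rewrite /= (negPf H).
move=> m1 F1 thr1; apply/run_seq/(@run_for _ _ _ _ _ n
  (fun i m => forall i', i' <= i -> nmem m aMul i' = i' * n)) => //.
- by move=> m F; rewrite /=; fr F; fr F1.
- by move=> i' /=; rewrite leqn0 => /eqP->; fr F1.
- move=> i m lt_i xi F I2; apply: run_nset => /= i'.
  have mn : nmem m 0 0 = n by fr F; fr F1.
  rewrite xi mn addn1 leq_eqVlt => /predU1P[->|lt_i']; last by rewrite ltn_eqF // I2.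
  by rewrite eqxx I2 // mulSn addnC.
move=> m2 F2 mul2; apply/run_seq/run_nset/run_seq => /=; set m3 := Memory _ _.
have m3n : nmem m3 aHdr 0 = n by rewrite /m3 /=; fr F2; fr F1.
apply: (@run_while _ _ _ _ (fun j m => [/\ nmem m xPow 0 = 2 ^ j, nmem m xLog 0 = j
    & 2 ^ j <= n.*2.+1])).
- by split=> //=; fr F2; fr F1.
- move=> j m F [pj lj le_j] /=; have mn : nmem m 0 0 = n by fr F; fr F2; fr F1.
  rewrite mn pj addn1 => lt_j; split.
    by apply: leq_trans nN; apply: leq_trans lt_j; rewrite ltnS ltnW // ltn_expl.
  apply/run_seq/run_nset/run_nset => /=; rewrite pj lj addn1 expnS mul2n addnn.
  by split=> //; lia.
move=> j m F [pj lj le_j] /=; have mn : nmem m 0 0 = n by fr F; fr F2; fr F1.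
rewrite mn pj addn1 -leqNgt => ge_j; apply: run_nset => /=; rewrite mn lj; split.
- by fr F; fr F2.
- by move=> i le_i; fr F; fr F2; apply: mul2.
- by rewrite ge_j.
have -> : nmem m aMul n = n * n by fr F; fr F2; apply: mul2.
by move=> i; case: eqP => // _; fr F; fr F2; fr F1.
Qed.

Lemma run_pairs m :
  nmem m aHdr 1 = k -> (forall i, i <= n -> nmem m aMul i = i * n) ->
  (forall i : 'I_k, nmem m aSrc i = src i) -> (forall i : 'I_k, nmem m aSnk i = snk i) ->
  (forall i, nmem m aPair i = (i == n * n + n)) ->
  run k pairs_cmd m (fun m' => forall i, (0 < nmem m' aPair i) =
     (i == n * n + n) || [exists j : 'I_k, i == src j * n + snk j]).
Proof.
move=> mk mM mS mT mP; apply: (@run_for _ _ _ _ _ k (fun j m' => forall i,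
  (0 < nmem m' aPair i) =
  (i == n * n + n) || [exists j' : 'I_k, (j' < j) && (i == src j' * n + snk j')])) => //.
- by move=> m' F; rewrite /=; fr F.
- move=> i /=; rewrite mP lt0b; case: existsP => [[?]//|_]; by rewrite orbF.
- move=> j m' lt_j xj F Ij; apply: run_nset => /= i; pose p := Ordinal lt_j.
  have m'S : nmem m' aSrc j = src p by fr F; apply: (mS p).
  have m'T : nmem m' aSnk j = snk p by fr F; apply: (mT p).
  have m'M : nmem m' aMul (src p) = src p * n.
    by fr F; apply: mM; apply/ltnW/ltn_ord.
  have exE : [exists j' : 'I_k, (j' < j.+1) && (i == src j' * n + snk j')] =
      (i == src p * n + snk p) || [exists j' : 'I_k, (j' < j) && (i == src j' * n + snk j')].
    apply/existsP/orP => [[j' /andP[]]|[ip|/existsP[j' /andP[lt_j' ij']]]].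
    - rewrite ltnS leq_eqVlt => /predU1P[eq_j|lt_j'] ij'.
        by left; have -> : p = j' by [apply: val_inj].
      by right; apply/existsP; exists j'; rewrite lt_j'.
    - by exists p; rewrite /= ltnSn.
    - by exists j'; rewrite ltnW.
  rewrite xj m'S m'T m'M exE; case: eqP => [_|_]; first by rewrite orbT.
  by rewrite Ij.
move=> m' F Pm' i; rewrite Pm'; congr (_ || _); apply: eq_existsb => j.
by rewrite ltn_ord.
Qed.

Lemma encode_graph : has_graph I (encode I).
Proof.
by split=> u v; rewrite /= row_major_at // => ->.
Qed.

Lemma encode_adj_sentinel (u : 'I_n) : nmem (encode I) aAdj (n * n + u) = 0.
Proof.
have n_gt0 : 0 < n by apply: leq_ltn_trans (ltn_ord u).
rewrite /= /row_major divnMDl // divn_small // addn0.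
by case: insubP => // v; rewrite ltnn.
Qed.

Definition total (S : {set 'I_k}) (P : 'I_k -> seq 'I_n) : nat :=
  \sum_(i in S) (size (P i)).+1.

Lemma solutionE (S : {set 'I_k}) (P : 'I_k -> seq 'I_n) :
  solution S P <-> threshold <= #|S| /\ valid S P.
Proof.
by rewrite /solution thresholdE; split=> [[? ? ?]|[? [? ?]]]; split.
Qed.

Lemma total_le_ell (S : {set 'I_k}) (P : 'I_k -> seq 'I_n) :
  valid S P -> total S P <= 2 * \sum_(i in S) size (P i).
Proof.
case=> short _; rewrite big_distrr; apply: leq_sum => i /short[[_ _ lp] _].
by case: (P i) lp => [/= eq_i|v p _ /=]; [have := src_neq_snk i; rewrite eq_i eqxx | lia].
Qed.

Lemma size_trace_enum (S : {set 'I_k}) (P : 'I_k -> seq 'I_n) :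
  size (trace P (enum S)) = total S P.
Proof. by rewrite size_trace /total big_enum. Qed.

Lemma total_le_n (S : {set 'I_k}) (P : 'I_k -> seq 'I_n) : valid S P -> total S P <= n.
Proof.
move=> vSP; rewrite -size_trace_enum.
have /card_uniqP <- : uniq (trace P (enum S)).
  by apply: uniq_trace vSP _ (enum_uniq _) => i; rewrite mem_enum.
by rewrite -[X in _ <= X]card_ord max_card.
Qed.

Lemma solution_ge_ell j : j <= n ->
  (forall S P, solution S P -> j <= total S P) -> j <= 2 * ell I.
Proof.
move=> le_jn le_j; rewrite /ell; case: pselect => [ex_l|_]; last by rewrite -/n; lia.
case: ex_minnP => l /asboolP[S [P [SP <-]]] _.
by rewrite (leq_trans (le_j _ _ SP)) // total_le_ell //; have [] := (solutionE S P).1 SP.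
Qed.

Lemma run_main N m (lg := nmem m xLog 0) (close := close_of n m) (step := step_of n m) :
  nmem m aHdr 0 = n -> nmem m xThr 0 = threshold -> nmem m xAns 0 = 0 -> nmem m xK 0 = 0 ->
  (forall i, i <= n -> nmem m aMul i = i * n) ->
  n <= 2 ^ lg <= n.*2.+1 ->
  4 * n.+1 ^ 6 * 2 ^ (4 * ell I) <= N ->
  (forall s v : 'I_n, close s v = [exists i, (src i == s) && (snk i == v)]) ->
  close n n ->
  (forall s v u : 'I_n, step s v u = [&& edge v u, 0 < nmem m aReach (s * n + v)
     & (wmem m 1 (s * n + v) + wt v u <= wmem m 1 (s * n + u))%R]) ->
  (forall u : 'I_n, step n n u = false) ->
  sound I m ->
  (forall (s : 'I_n) p, path (@edge I) s p -> size p <= n ->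
     known m s (last s p) (path_length s p)) ->
  run N main_cmd m (fun m' => nmem m' 0 0 <> 0 <-> yes_instance I).
Proof.
move=> mn mthr mans mK mM /andP[le_lg lg_le] leN closeE close_n stepE step_n snd kn.
have D_le (s : 'I_n) p : path (@edge I) s p -> size p <= n ->
    0 < nmem m aReach (s * n + last s p) /\
    (wmem m 1 (s * n + last s p) <= path_length s p)%R by move=> sp; apply: kn.
have bigN j : j <= 2 * ell I -> n.+1 ^ 4 * 2 ^ ((lg + j) + (lg + j)) <= N.
  move=> le_j; apply: leq_trans leN.
  have -> : 2 ^ (lg + j + (lg + j)) = (2 ^ lg) ^ 2 * 2 ^ (2 * j).
    by rewrite -expnM -expnD; congr (2 ^ _); lia.
  rewrite (_ : 4 * n.+1 ^ 6 = n.+1 ^ 4 * (2 * n.+1) ^ 2); last first.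
    by rewrite expnMn (mulnCA _ (2 ^ 2)) -expnD.
  rewrite -mulnA leq_mul2l leq_mul ?orbT //.
    by rewrite leq_exp2r // (leq_trans lg_le) //; lia.
  by rewrite leq_exp2l //; lia.
have n4_gt0 : 0 < n.+1 ^ 4 by rewrite expn_gt0.
have n_lt4 : n < n.+1 ^ 4 by rewrite -[n.+1 in X in X <= _]expn1 leq_pexp2l.
have nN : n < N.
  apply: leq_trans (bigN 0 _) => //; rewrite (leq_trans n_lt4) // leq_pmulr //.
  by rewrite expn_gt0.
pose Inv j m' := [/\ nmem m' xK 0 = j, nmem m' xAns 0 <> 0 -> yes_instance I &
  nmem m' xAns 0 = 0 -> forall S P, solution S P -> j <= total S P].
apply: run_seq; apply: (@run_while _ _ _ _ Inv).
- by split.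
- move=> j m1 F1 [Kj _ noj] /=.
  have m1n : nmem m1 aHdr 0 = n by fr F1.
  rewrite m1n Kj leqn0 => /andP[/eqP ans0 le_jn].
  split; first exact: leq_ltn_trans nN.
  have le_jl : j <= 2 * ell I by apply: solution_ge_ell => //; apply: noj.
  have m1close : close_of n m1 = close by rewrite /close /close_of; fr F1.
  have m1step : step_of n m1 = step by rewrite /step /step_of; fr F1.
  have m1lg : nmem m1 xLog 0 = lg by fr F1.
  have m1M i : i <= n -> nmem m1 aMul i = i * n by fr F1; apply: mM.
  have m1thr : nmem m1 xThr 0 = threshold by fr F1.
  have kN : 2 ^ (lg + j + (lg + j)) <= N.
    by apply: leq_trans (bigN j le_jl); rewrite leq_pmull.
  have sN (L : seq (entry n)) : good (lg + j) close step L -> size L <= N.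
    by move/good_size => le_L; apply: leq_trans le_L (bigN j le_jl).
  apply: run_seq; apply: run_conseq
    (@run_search N n lg j threshold m1 m1n m1lg Kj m1thr ans0 (ltnW nN) kN _ m1M) _.
    by rewrite m1close m1step.
  rewrite m1close m1step => m2 F2 [L [gL L0 closedL ans]].
  apply: run_nset => /=; split=> /=.
  + by fr F2; rewrite Kj addn1.
  + rewrite ans; case: hasP => // -[[[[[s v] c] j'] A] eL /=] /andP[cl le_c] _.
    have [rL _] := gL.
    have [S [P [vSP cS]]] := reached_valid snd D_le closeE close_n stepE step_n (rL _ eL) cl.
    by exists S, P; apply/solutionE; rewrite cS.
  + rewrite ans => /eqP; rewrite eqb0 => /hasPn no S P SP.
    rewrite ltn_neqAle noj // andbT; apply/negP => /eqP eq_j.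
    have [le_S vSP] := (solutionE S P).1 SP; have [short _] := vSP.
    have short' i : i \in enum S -> is_shortest_path (src i) (snk i) (P i).
      by rewrite mem_enum; apply: short.
    have uS : uniq (trace P (enum S)).
      by apply: uniq_trace vSP _ (enum_uniq _) => i; rewrite mem_enum.
    have [s' [v' [j' [st cl]]]] := valid_steps snd D_le closeE stepE 0 0 short' close_n.
    have le_2 : n * 2 ^ j <= 2 ^ (lg + j) by rewrite expnD leq_mul2r le_lg orbT.
    have le_tr : size (trace P (enum S)) <= j by rewrite size_trace_enum -eq_j.
    have [A LA] := covered_steps le_2 gL L0 closedL uS le_tr st.
    by have /negP[] := no _ LA; rewrite /= cl add0n -cardE.
move=> j m1 F1 [Kj yes noj] /=.
have m1n : nmem m1 aHdr 0 = n by fr F1.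
rewrite m1n Kj => stop; apply: run_nset => /=; split=> // yesI ans0.
move: stop; rewrite ans0 /= -ltnNge => lt_nj.
have [S [P SP]] := yesI.
have := leq_trans lt_nj (noj ans0 S P SP).
by rewrite ltnNge total_le_n //; have [] := (solutionE S P).1 SP.
Qed.

End Algorithm.

Theorem theorem4 :
  exists (prog : cmd) (c : nat) (q : {poly nat}),
    decides_MVDSP_in_time prog
      (fun I : instance =>
         (2 ^ (c * ell I) * (q.[nv I])%R + c * npairs I)%N).
Proof.
have [C [d costP]] := cost_poly (prelude_cmd ;; distances_cmd ;; main_cmd)%cmd.
exists mvdsp_cmd, (4 * d + 3), (((C + 2) * 4 ^ d)%N%:P * ('X + 1%:P) ^+ (6 * d)%N)%R => I.
pose n := nv I; pose k := npairs I; pose N := 4 * n.+1 ^ 6 * 2 ^ (4 * ell I).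
have N_gt0 : 0 < N by rewrite !muln_gt0 !expn_gt0.
have nN : n <= N.
  rewrite /N -mulnA (leq_trans _ (leq_pmull _ _)) // (leq_trans _ (leq_pmulr _ _)) ?expn_gt0 //.
  by rewrite (leq_trans (leqnSn n)) // -[X in X <= _]expn1 leq_pexp2l.
have [t1 [m1 [E1 le1 [thr1 mul1 log1 pair1]]]] := run_prelude nN.
have F1 := exec_frame E1.
have [|||t2 [m2 [E2 le2 pair2]]] := @run_pairs I m1 _ mul1 _ _ pair1.
- by fr F1.
- by move=> i; fr F1; rewrite /= /ord_array valK.
- by move=> i; fr F1; rewrite /= /ord_array valK.
have F2 := exec_frame E2.
have mul2 i : i <= n -> nmem m2 aMul i = i * n by fr F2; apply: mul1.
have [||||t3 [m3 [E3 le3 [snd3 kn3]]]] := @run_distances I N m2 _ nN _ mul2.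
- by fr F2; fr F1.
- by have := encode_graph I; rewrite /has_graph; fr F2; fr F1.
- by move=> i; fr F2; fr F1.
- by move=> i; fr F2; fr F1.
have F3 := exec_frame E3.
have n_sq (s v : 'I_n) : s * n + v < n * n.
  have lt_s := ltn_ord s; have lt_v := ltn_ord v.
  by rewrite (@leq_trans (s.+1 * n)) ?leq_mul2r ?lt_s ?orbT // mulSn addnC ltn_add2r.
have [t4 [m4 [E4 le4 ansP]]] : run N main_cmd m3 (fun m' => nmem m' 0 0 <> 0 <-> yes_instance I).
  apply: run_main => //.
  - by fr F3; fr F2; fr F1.
  - by fr F3; fr F2.
  - by fr F3; fr F2; fr F1.
  - by fr F3; fr F2; fr F1.
  - by move=> i le_i; fr F3; apply: mul2.
  - by fr F3; fr F2.
  - move=> s v; rewrite /close_of; fr F3; rewrite pair2.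
    rewrite ltn_eqF /= ?ltn_addr ?n_sq //; apply: eq_existsb => i.
    by apply/eqP/andP => [/cell_index_inj[<- <-]|[/eqP-> /eqP->]].
  - by rewrite /close_of; fr F3; rewrite pair2 eqxx.
  - move=> s v u; rewrite /step_of; fr F3; fr F2; fr F1.
    have [-> wE] := encode_graph I; rewrite lt0b.
    by case: (boolP (edge v u)) => // vu; rewrite wE.
  - move=> u; rewrite /step_of; fr F3; fr F2; fr F1.
    by rewrite encode_adj_sentinel.
exists (t1 + (t2 + (t3 + t4))), m4; split=> //.
  by apply: ExecSeq E1 _; apply: ExecSeq E2 _; apply: ExecSeq E3 E4.
have cost_pairs : cost k pairs_cmd = 3 * k + 2 by rewrite /=; lia.
have le_cost : cost N prelude_cmd + (cost N distances_cmd + cost N main_cmd) <= C * N ^ d.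
  exact: costP N N_gt0.
have Nd_gt0 : 0 < N ^ d by rewrite expn_gt0 N_gt0.
have le_Nd : (C + 2) * N ^ d <=
    2 ^ ((4 * d + 3) * ell I) * ((C + 2) * 4 ^ d * n.+1 ^ (6 * d)).
  rewrite /N expnMn expnMn -!expnM [X in _ <= X]mulnC -!mulnA !leq_mul2l.
  by rewrite leq_exp2l // mulnA mulnAC leq_mul2r leq_addr !orbT.
have qE : (((C + 2) * 4 ^ d)%N%:P * ('X + 1%:P) ^+ (6 * d)%N).[nv I]%R =
    (C + 2) * 4 ^ d * n.+1 ^ (6 * d).
  by rewrite !hornerE natrXE (_ : (nv I + 1)%R = n.+1) //; apply: addn1.
rewrite qE.
have : (C + 2) * N ^ d = C * N ^ d + 2 * N ^ d by rewrite mulnDl.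
have : 3 * k <= (4 * d + 3) * npairs I by rewrite leq_mul2r leq_addl orbT.
rewrite cost_pairs in le2; lia.
Qed.
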